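(* Let $K$ be a field and let $\mathcal{G}$ be an ultragraph (possibly with sinks). Then the ultragraph Leavitt path algebra $L_K(\mathcal{G})$ is semiprimitive.
   Context: An ultragraph $\mathcal{G}=(G^0,\mathcal{G}^1,r,s)$ consists of a countable set $G^0$ of vertices, a countable set $\mathcal{G}^1$ of edges, and maps $s:\mathcal{G}^1\to G^0$, $r:\mathcal{G}^1\to\mathcal{P}(G^0)\setminus\{\varnothing\}$. A vertex $v$ is a sink if $s^{-1}(v)=\varnothing$, and regular if $0<|s^{-1}(v)|<\infty$. $\mathcal{G}^0$ is the smallest subset of $\mathcal{P}(G^0)$ containing all $\{v\}$ ($v\in G^0$) and all $r(e)$ ($e\in\mathcal{G}^1$) and closed under finite unions and finite intersections. $L_K(\mathcal{G})$ is the $K$-algebra generated by $\{s_e,s_e^*: e\in\mathcal{G}^1\}\cup\{p_A: A\in\mathcal{G}^0\}$ subject to, for all $A,B\in\mathcal{G}^0$, $e,f\in\mathcal{G}^1$: (1) $p_\varnothing=0$, $p_Ap_B=p_{A\cap B}$, $p_{A\cup B}=p_A+p_B-p_{A\cap B}$; (2) $p_{s(e)}s_e=s_e=s_ep_{r(e)}$ and $p_{r(e)}s_e^*=s_e^*=s_e^*p_{s(e)}$; (3) $s_e^*s_f=\delta_{e,f}p_{r(e)}$; (4) $p_v=\sum_{s(e)=v}s_es_e^*$ for every regular vertex $v$ (with $p_v:=p_{\{v\}}$). It need not have a unit. A ring is semiprimitive if it has a faithful semisimple module. *)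

(* Defs.v *)
From HB Require Import structures.
From mathcomp Require Import all_boot all_order all_algebra.
From mathcomp Require Import finmap.
From mathcomp Require Import all_classical.

Set Implicit Arguments.
Unset Strict Implicit.
Unset Printing Implicit Defensive.

Import GRing.Theory.
Local Open Scope classical_set_scope.
Local Open Scope ring_scope.

HB.mixin Record Zmodule_isRng R of GRing.Zmodule R := {
  rngmul : R -> R -> R;
  rngmulA : associative rngmul;
  rngmulDl : left_distributive rngmul +%R;
  rngmulDr : right_distributive rngmul +%R
}.

#[short(type="rngType")]
HB.structure Definition Rng := {R of GRing.Zmodule R & Zmodule_isRng R}.

Declare Scope rng_scope.
Delimit Scope rng_scope with rng.
Notation "x ** y" := (rngmul x y) (at level 40, left associativity) : rng_scope.
Local Open Scope rng_scope.

HB.mixin Record Lmodule_Rng_isRngAlg (K : fieldType) A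
    of GRing.Lmodule K A & Rng A := {
  rngscalerAl : forall (k : K) (x y : A), k *: (x ** y) = (k *: x) ** y;
  rngscalerAr : forall (k : K) (x y : A), k *: (x ** y) = x ** (k *: y)
}.

#[short(type="rngAlgType")]
HB.structure Definition RngAlg (K : fieldType) :=
  {A of GRing.Lmodule K A & Rng A & Lmodule_Rng_isRngAlg K A}.

Record rngModule (R : rngType) := RngModule {
  rmod_carrier :> zmodType;
  ract : R -> rmod_carrier -> rmod_carrier;
  ractA : forall r t x, ract (r ** t) x = ract r (ract t x);
  ractDl : forall r t x, ract (r + t) x = ract r x + ract t x;
  ractDr : forall r x y, ract r (x + y) = ract r x + ract r y
}.

Section Modules.
Variables (R : rngType) (M : rngModule R).

Definition is_submodule (N : set M) :=
  [/\ N 0,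
      (forall x y, N x -> N y -> N (x - y)) &
      (forall r x, N x -> N (ract r x))].

(* In the absence of a unit, R N <> 0 is not implied by N <> 0: it rules out
   the abelian groups of prime order on which R acts by zero. *)
Definition is_simple_submodule (N : set M) :=
  [/\ is_submodule N,
      (exists r x, N x /\ ract r x <> 0) &
      (forall N' : set M, is_submodule N' -> N' `<=` N ->
         N' = [set 0] \/ N' = N)].

Definition is_direct_sum (I : choiceType) (N : I -> set M) :=
  forall x : M, exists! f : I -> M,
    [/\ (forall i, N i (f i)),
        finite_set [set i | f i <> 0] &
        x = \sum_(i \in [set: I]) f i].

Definition is_semisimple :=
  exists (I : choiceType) (N : I -> set M),
    (forall i, is_simple_submodule (N i)) /\ is_direct_sum N.

Definition is_faithful :=
  forall r : R, (forall x : M, ract r x = 0) -> r = 0.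

End Modules.

Definition semiprimitive (R : rngType) :=
  exists M : rngModule R, is_faithful M /\ is_semisimple M.

Record ultragraph := Ultragraph {
  vertex : countType;
  edge : countType;
  edge_source : edge -> vertex;
  edge_range : edge -> set vertex;
  edge_range_neq0 : forall e, edge_range e !=set0
}.

Section Ultragraphs.
Variable G : ultragraph.

Definition out_edges (v : vertex G) : set (edge G) :=
  @edge_source G @^-1` [set v].

Definition regular (v : vertex G) :=
  out_edges v !=set0 /\ finite_set (out_edges v).

(* "Finite unions" includes the empty one, so that the empty set is a
   generalized vertex; the relation p_set0 = 0 presupposes this. *)
Definition genvertex : set (set (vertex G)) :=
  smallest [set C | [/\ C set0, setU_closed C & setI_closed C]]
    ([set A | exists v, A = [set v]] `|` [set A | exists e, A = edge_range e]).

Lemma genvertex0 : genvertex set0.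
Proof. by move=> C [[]]. Qed.

Lemma genvertexU : setU_closed genvertex.
Proof.
move=> A B gA gB C CG; have [[_ CU _] _] := CG.
by apply: CU; [exact: gA | exact: gB].
Qed.

Lemma genvertexI : setI_closed genvertex.
Proof.
move=> A B gA gB C CG; have [[_ _ CI] _] := CG.
by apply: CI; [exact: gA | exact: gB].
Qed.

Lemma genvertex1 v : genvertex [set v].
Proof. by move=> C [_ GC]; apply: GC; left; exists v. Qed.

Lemma genvertex_range e : genvertex (edge_range e).
Proof. by move=> C [_ GC]; apply: GC; right; exists e. Qed.

End Ultragraphs.

Section LeavittTerms.
Variables (K : fieldType) (G : ultragraph).

Inductive lterm : Type :=
| lproj (A : set (vertex G)) of genvertex A
| ledge of edge G
| lghost of edge G
| lzero
| lopp of lterm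
| ladd of lterm & lterm
| lscale of K & lterm
| lmul of lterm & lterm.

(* The least congruence on terms containing the axioms of (not necessarily
   unital) associative K-algebras and the defining relations of L_K(G); the
   quotient is the K-algebra presented by these generators and relations. *)
Inductive lequiv : lterm -> lterm -> Prop :=
| lequiv_refl x : lequiv x x
| lequiv_sym x y : lequiv x y -> lequiv y x
| lequiv_trans y x z : lequiv x y -> lequiv y z -> lequiv x z
| lequiv_opp x x' : lequiv x x' -> lequiv (lopp x) (lopp x')
| lequiv_add x x' y y' :
    lequiv x x' -> lequiv y y' -> lequiv (ladd x y) (ladd x' y')
| lequiv_scale k x x' : lequiv x x' -> lequiv (lscale k x) (lscale k x')
| lequiv_mul x x' y y' :
    lequiv x x' -> lequiv y y' -> lequiv (lmul x y) (lmul x' y')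
| lequiv_addA x y z : lequiv (ladd x (ladd y z)) (ladd (ladd x y) z)
| lequiv_addC x y : lequiv (ladd x y) (ladd y x)
| lequiv_add0 x : lequiv (ladd lzero x) x
| lequiv_addN x : lequiv (ladd (lopp x) x) lzero
| lequiv_scaleA a b x : lequiv (lscale a (lscale b x)) (lscale (a * b) x)
| lequiv_scale1 x : lequiv (lscale 1 x) x
| lequiv_scaleDr a x y :
    lequiv (lscale a (ladd x y)) (ladd (lscale a x) (lscale a y))
| lequiv_scaleDl a b x :
    lequiv (lscale (a + b) x) (ladd (lscale a x) (lscale b x))
| lequiv_mulA x y z : lequiv (lmul x (lmul y z)) (lmul (lmul x y) z)
| lequiv_mulDl x y z :
    lequiv (lmul (ladd x y) z) (ladd (lmul x z) (lmul y z))
| lequiv_mulDr x y z :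
    lequiv (lmul x (ladd y z)) (ladd (lmul x y) (lmul x z))
| lequiv_scaleAl a x y : lequiv (lscale a (lmul x y)) (lmul (lscale a x) y)
| lequiv_scaleAr a x y : lequiv (lscale a (lmul x y)) (lmul x (lscale a y))
| lequiv_p0 : lequiv (lproj (@genvertex0 G)) lzero
| lequiv_pI A B (gA : genvertex A) (gB : genvertex B) :
    lequiv (lmul (lproj gA) (lproj gB)) (lproj (genvertexI gA gB))
| lequiv_pU A B (gA : genvertex A) (gB : genvertex B) :
    lequiv (lproj (genvertexU gA gB))
      (ladd (ladd (lproj gA) (lproj gB)) (lopp (lproj (genvertexI gA gB))))
| lequiv_ps e :
    lequiv (lmul (lproj (genvertex1 (edge_source e))) (ledge e)) (ledge e)
| lequiv_sp e :
    lequiv (lmul (ledge e) (lproj (genvertex_range e))) (ledge e)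
| lequiv_pg e :
    lequiv (lmul (lproj (genvertex_range e)) (lghost e)) (lghost e)
| lequiv_gp e :
    lequiv (lmul (lghost e) (lproj (genvertex1 (edge_source e)))) (lghost e)
| lequiv_gs_eq e :
    lequiv (lmul (lghost e) (ledge e)) (lproj (genvertex_range e))
| lequiv_gs_neq e f : e <> f -> lequiv (lmul (lghost e) (ledge f)) lzero
| lequiv_sg v : regular v ->
    lequiv (lproj (genvertex1 v))
      (\big[ladd/lzero]_(e <- fset_set (out_edges v))
         lmul (ledge e) (lghost e)).

HB.instance Definition _ := gen_eqMixin lterm.
HB.instance Definition _ := gen_choiceMixin lterm.

Definition lequivb (x y : lterm) : bool := `[< lequiv x y >].

Lemma lequivb_equiv : equiv_class_of lequivb.
Proof.
split.
- by move=> x; apply/asboolP; exact: lequiv_refl.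
- by move=> x y; apply/asboolP/asboolP; exact: lequiv_sym.
- move=> y x z /asboolP xy /asboolP yz; apply/asboolP.
  exact: lequiv_trans xy yz.
Qed.

Canonical lequivb_equivRel := EquivRelPack lequivb_equiv.

Definition leavitt := {eq_quot lequivb}%qT.

HB.instance Definition _ := Choice.on leavitt.

Definition lclass (x : lterm) : leavitt := (\pi_leavitt x)%qT.

Lemma lclassP (x y : lterm) : lclass x = lclass y <-> lequiv x y.
Proof. by split=> [/eqmodP/asboolP|xy]; last exact/eqmodP/asboolP. Qed.

Lemma reprlK (x : leavitt) : lclass (repr x) = x.
Proof. exact: reprK. Qed.

Lemma lequiv_repr (x : lterm) : lequiv (repr (lclass x)) x.
Proof. by apply/lclassP; rewrite reprlK. Qed.

Definition leavitt_opp (x : leavitt) := lclass (lopp (repr x)).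
Definition leavitt_add (x y : leavitt) := lclass (ladd (repr x) (repr y)).
Definition leavitt_scale k (x : leavitt) := lclass (lscale k (repr x)).
Definition leavitt_mul (x y : leavitt) := lclass (lmul (repr x) (repr y)).

Let oppE x : leavitt_opp (lclass x) = lclass (lopp x).
Proof. by apply/lclassP/lequiv_opp/lequiv_repr. Qed.

Let addE x y : leavitt_add (lclass x) (lclass y) = lclass (ladd x y).
Proof. by apply/lclassP/lequiv_add; exact: lequiv_repr. Qed.

Let scaleE k x : leavitt_scale k (lclass x) = lclass (lscale k x).
Proof. by apply/lclassP/lequiv_scale/lequiv_repr. Qed.

Let mulE x y : leavitt_mul (lclass x) (lclass y) = lclass (lmul x y).
Proof. by apply/lclassP/lequiv_mul; exact: lequiv_repr. Qed.

Fact leavitt_addA : associative leavitt_add.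
Proof.
move=> x y z; rewrite -(reprlK x) -(reprlK y) -(reprlK z)
  !(oppE, addE, scaleE, mulE).
exact/lclassP/lequiv_addA.
Qed.

Fact leavitt_addC : commutative leavitt_add.
Proof.
move=> x y; rewrite -(reprlK x) -(reprlK y) !(oppE, addE, scaleE, mulE).
exact/lclassP/lequiv_addC.
Qed.

Fact leavitt_add0 : left_id (lclass lzero) leavitt_add.
Proof.
move=> x; rewrite -(reprlK x) !(oppE, addE, scaleE, mulE).
exact/lclassP/lequiv_add0.
Qed.

Fact leavitt_addN : left_inverse (lclass lzero) leavitt_opp leavitt_add.
Proof.
move=> x; rewrite -(reprlK x) !(oppE, addE, scaleE, mulE).
exact/lclassP/lequiv_addN.
Qed.

Fact leavitt_mulA : associative leavitt_mul.
Proof.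
move=> x y z; rewrite -(reprlK x) -(reprlK y) -(reprlK z)
  !(oppE, addE, scaleE, mulE).
exact/lclassP/lequiv_mulA.
Qed.

Fact leavitt_mulDl : left_distributive leavitt_mul leavitt_add.
Proof.
move=> x y z; rewrite -(reprlK x) -(reprlK y) -(reprlK z)
  !(oppE, addE, scaleE, mulE).
exact/lclassP/lequiv_mulDl.
Qed.

Fact leavitt_mulDr : right_distributive leavitt_mul leavitt_add.
Proof.
move=> x y z; rewrite -(reprlK x) -(reprlK y) -(reprlK z)
  !(oppE, addE, scaleE, mulE).
exact/lclassP/lequiv_mulDr.
Qed.

Fact leavitt_scaleA a b (x : leavitt) :
  leavitt_scale a (leavitt_scale b x) = leavitt_scale (a * b) x.
Proof.
rewrite -(reprlK x) !scaleE; exact/lclassP/lequiv_scaleA.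
Qed.

Fact leavitt_scale1 : left_id 1 leavitt_scale.
Proof.
move=> x; rewrite -(reprlK x) !(oppE, addE, scaleE, mulE).
exact/lclassP/lequiv_scale1.
Qed.

Fact leavitt_scaleDr : right_distributive leavitt_scale leavitt_add.
Proof.
move=> a x y; rewrite -(reprlK x) -(reprlK y) !(oppE, addE, scaleE, mulE).
exact/lclassP/lequiv_scaleDr.
Qed.

Fact leavitt_scaleDl (x : leavitt) :
  {morph leavitt_scale^~ x : a b / a + b >-> leavitt_add a b}.
Proof.
move=> a b; rewrite -(reprlK x) !(oppE, addE, scaleE, mulE).
exact/lclassP/lequiv_scaleDl.
Qed.

Fact leavitt_scaleAl : forall k x y,
  leavitt_scale k (leavitt_mul x y) = leavitt_mul (leavitt_scale k x) y.
Proof.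
move=> k x y; rewrite -(reprlK x) -(reprlK y) !(oppE, addE, scaleE, mulE).
exact/lclassP/lequiv_scaleAl.
Qed.

Fact leavitt_scaleAr : forall k x y,
  leavitt_scale k (leavitt_mul x y) = leavitt_mul x (leavitt_scale k y).
Proof.
move=> k x y; rewrite -(reprlK x) -(reprlK y) !(oppE, addE, scaleE, mulE).
exact/lclassP/lequiv_scaleAr.
Qed.

HB.instance Definition _ := GRing.isZmodule.Build leavitt
  leavitt_addA leavitt_addC leavitt_add0 leavitt_addN.
HB.instance Definition _ := Zmodule_isRng.Build leavitt
  leavitt_mulA leavitt_mulDl leavitt_mulDr.
HB.instance Definition _ := GRing.Zmodule_isLmodule.Build K leavitt
  leavitt_scaleA leavitt_scale1 leavitt_scaleDr leavitt_scaleDl.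
HB.instance Definition _ := Lmodule_Rng_isRngAlg.Build K leavitt
  leavitt_scaleAl leavitt_scaleAr.

Lemma lclass0 : lclass lzero = 0.
Proof. by []. Qed.

Lemma lclassN x : lclass (lopp x) = - lclass x.
Proof. by rewrite -oppE. Qed.

Lemma lclassD x y : lclass (ladd x y) = lclass x + lclass y.
Proof. by rewrite -addE. Qed.

Lemma lclassZ k x : lclass (lscale k x) = k *: lclass x.
Proof. by rewrite -scaleE. Qed.

Lemma lclassM x y : lclass (lmul x y) = lclass x ** lclass y.
Proof. by rewrite -mulE. Qed.

Lemma lclass_sum (I : Type) (r : seq I) (F : I -> lterm) :
  lclass (\big[ladd/lzero]_(i <- r) F i) = \sum_(i <- r) lclass (F i).
Proof. by apply: (big_morph lclass lclassD lclass0). Qed.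

End LeavittTerms.

(* Main.v *)
Require Import Defs.
From HB Require Import structures.
From mathcomp Require Import all_boot all_order all_algebra.
From mathcomp Require Import finmap.
From mathcomp Require Import all_classical.

Set Implicit Arguments.
Unset Strict Implicit.
Unset Printing Implicit Defensive.

Import Order.TTheory GRing.Theory Num.Theory.
Local Open Scope classical_set_scope.
Local Open Scope ring_scope.
Local Open Scope rng_scope.

(* The radical J of L_K(G), the set of elements annihilating all simple modules,
   is a two-sided ideal whose elements are quasi-regular. A nonzero x in J can be
   moved, multiplying it on both sides, to an element p_w + g of J with g a
   linear combination of closed paths of positive length at w. If g = 0 then
   p_w is an idempotent of J, hence 0. Otherwise g (p_w + g) = g + g^2 is in J, yet
   p_w + g + g^2 is not invertible: in a Z-graded representation of L_K(G), g
   shifts the top degree of every vector fixed by p_w by the same positive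
   amount, so that p_w + g + g^2 behaves like a polynomial of positive degree
   with constant term 1. *)

(** The factor g in front of p_w + g is what makes quasi-regularity effective. Applied to p_w + g
    itself, it only makes 2 p_w + g invertible in the corner at w; in characteristic 2, or for -(p_w
    + g), what remains is g up to sign, and this can be a unit: a single loop gives the Laurent
    polynomials. The product g + g^2 has no constant term, so p_w + g + g^2 has parts of different
    degrees in every characteristic. Two obstacles shape the reduction to p_w + g. For infinite A,
    p_A is not a sum of vertex projections, so inclusion-exclusion is needed to see that a
    combination of the p_A vanishes once it vanishes at each vertex. And at a vertex emitting
    infinitely many edges relation (4) is absent, so an element that annihilates all edges there is
    not at once seen to annihilate the vertex. *)

Section RngTheory.
Variable R : rngType.
Implicit Types x y z : R.

Lemma rng0l x : 0 ** x = 0.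
Proof. by apply: (addrI (0 ** x)); rewrite -rngmulDl !addr0. Qed.

Lemma rng0r x : x ** 0 = 0.
Proof. by apply: (addrI (x ** 0)); rewrite -rngmulDr !addr0. Qed.

Lemma rngNl x y : (- x) ** y = - (x ** y).
Proof. by apply/eqP; rewrite -addr_eq0 -rngmulDl addNr rng0l. Qed.

Lemma rngNr x y : x ** (- y) = - (x ** y).
Proof. by apply/eqP; rewrite -addr_eq0 -rngmulDr addNr rng0r. Qed.

Lemma rngBl x y z : (x - y) ** z = x ** z - y ** z.
Proof. by rewrite rngmulDl rngNl. Qed.

Lemma rngBr x y z : x ** (y - z) = x ** y - x ** z.
Proof. by rewrite rngmulDr rngNr. Qed.

Lemma rng_suml (I : Type) (r : seq I) (P : pred I) (F : I -> R) x :
  (\sum_(i <- r | P i) F i) ** x = \sum_(i <- r | P i) F i ** x.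
Proof. exact: (big_morph _ (fun y z => rngmulDl y z x) (rng0l x)). Qed.

Lemma rng_sumr (I : Type) (r : seq I) (P : pred I) (F : I -> R) x :
  x ** (\sum_(i <- r | P i) F i) = \sum_(i <- r | P i) x ** F i.
Proof. exact: (big_morph _ (rngmulDr x) (rng0r x)). Qed.

End RngTheory.

(** * The Jacobson radical of a ring without unit *)

Section Radical.
Variable R : rngType.
Implicit Types (x y z a : R) (N : set R).

Definition left_ideal N :=
  [/\ N 0, (forall x y, N x -> N y -> N (x - y)) & (forall a x, N x -> N (a ** x))].

(* The left ideals N for which R / N is a simple module. *)
Definition cosimple N :=
  [/\ left_ideal N, (exists a x, ~ N (a ** x)) &
      (forall N', left_ideal N' -> N `<=` N' -> N' = N \/ N' = setT)].

Definition radical : set R :=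
  [set x | forall N, cosimple N -> forall a, N (x ** a)].

Lemma left_idealN N x : left_ideal N -> N x -> N (- x).
Proof. by case=> N0 NB _ Nx; rewrite -(sub0r x); exact: NB. Qed.

Lemma left_idealD N x y : left_ideal N -> N x -> N y -> N (x + y).
Proof.
move=> lN Nx Ny; rewrite -(opprK y); case: (lN) => _ + _; apply=> //.
exact: left_idealN.
Qed.

Lemma radicalN x : radical x -> radical (- x).
Proof.
move=> rx N sN a; rewrite rngNl; apply: left_idealN; first by case: sN.
exact: rx.
Qed.

Lemma radicalD x y : radical x -> radical y -> radical (x + y).
Proof.
move=> rx ry N sN a; rewrite rngmulDl; apply: left_idealD; first by case: sN.
- exact: rx.
- exact: ry.
Qed.

Lemma radicalMl x a : radical x -> radical (a ** x).
Proof.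
by move=> rx N sN b; rewrite -rngmulA; case: sN (rx _ sN b) => -[_ _ + _ _]; exact.
Qed.

Lemma radicalMr x a : radical x -> radical (x ** a).
Proof. by move=> rx N sN b; rewrite -rngmulA; exact: rx. Qed.

(* Otherwise a left ideal N maximal among those that contain R(1 + y) and omit
   y is cosimple; as y + y y is in N, y does not annihilate its own coset. *)
Lemma radical_left_quasiregular y : radical y -> exists z, z + y + z ** y = 0.
Proof.
move=> ry; apply: contrapT => nz.
pose I := [set x | exists z, x = z + z ** y].
(* Stated for the union of X with I, so that the empty chain, whose union is empty, satisfies it as
   well. *)
pose P X := left_ideal (X `|` I) /\ ~ (X `|` I) y.
have lI : left_ideal I.
  split; first by exists 0; rewrite rng0l addr0.
  - by move=> _ _ [z ->] [t ->]; exists (z - t); rewrite rngBl opprD addrACA.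
  - by move=> a _ [z ->]; exists (a ** z); rewrite rngmulDr rngmulA.
have nIy : ~ I y.
  move=> [z yE]; apply: nz; exists (- z).
  by rewrite rngNl {1}yE addrA addNr add0r addrN.
have [F FP Ftot|X [[lX nXy] Xmax]] := @Zorn_bigcup _ P.
  split; last first.
    by move=> [[X FX Xy]|//]; have [_] := FP _ FX; apply; left.
  split; first by right; case: lI.
  - move=> u v [[X FX Xu]|Iu] [[Y FY Yv]|Iv].
    + have [XY|YX] := Ftot _ _ FX FY.
      * have [[_ + _] _] := FP _ FY => /(_ u v); case=> [||Z|Z]; last by right.
        -- by left; exact: XY.
        -- by left.
        -- by left; exists Y.
      * have [[_ + _] _] := FP _ FX => /(_ u v); case=> [||Z|Z]; last by right.
        -- by left.
        -- by left; exact: YX.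
        -- by left; exists X.
    + have [[_ + _] _] := FP _ FX => /(_ u v); case=> [||Z|Z]; last by right.
      * by left.
      * by right.
      * by left; exists X.
    + have [[_ + _] _] := FP _ FY => /(_ u v); case=> [||Z|Z]; last by right.
      * by right.
      * by left.
      * by left; exists Y.
    + by right; case: lI => _ + _; exact.
  - move=> a u [[X FX Xu]|Iu]; last by right; case: lI => _ _; exact.
    have [[_ _ +] _] := FP _ FX => /(_ a u); case=> [|Z|Z]; last by right.
    + by left.
    + by left; exists X.
set N := X `|` I in lX nXy.
have IN a : N (a + a ** y) by right; exists a.
(* Every a is the difference of a + a y, which is in N, and a y. So a left ideal above N is proper
   exactly when it omits y. *)
have NyT N' : left_ideal N' -> N `<=` N' -> N' y -> N' = setT.
  move=> lN' NN' N'y; apply/seteqP; split=> // a _.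
  rewrite -(addrK (a ** y) a); case: (lN') => _ N'B N'M.
  by apply: N'B; [exact: NN' | exact: N'M].
have sN : cosimple N.
  split=> //.
    exists y, y => Nyy; apply: nXy; rewrite -(addrK (y ** y) y).
    by case: lX => _ + _; apply.
  move=> N' lN' NN'; have [N'y|nN'y] := pselect (N' y); first by right; exact: NyT.
  left; apply/seteqP; split=> // u N'u; apply: contrapT => nNu.
  have N'I : N' `|` I = N'.
    by apply/seteqP; split=> [v [//|Iv]|v]; [apply: NN'; right | left].
  apply: (Xmax N'); last by rewrite /P N'I.
  split; first by move=> v Xv; apply: NN'; left.
  by move=> N'X; apply: nNu; left; exact: N'X.
apply: nXy; rewrite -(addrK (y ** y) y); case: lX => _ + _; apply=> //.
exact: ry.
Qed.

(* 1 + circ x y is the product of 1 + x and 1 + y. *)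
Let circ x y := x + y + x ** y.

Let circA : associative circ.
Proof.
move=> x y z; rewrite /circ !rngmulDl !rngmulDr !rngmulA !addrA.
by rewrite [LHS](ACl (1*2*5*3*6*4*7))/=.
Qed.

(** A left quasi-inverse z of y equals -(y + z y), hence is in the radical and has a left
    quasi-inverse t of its own. Associativity of [circ] then forces t = y, so z is also a right
    quasi-inverse. *)
Lemma radical_right_quasiregular y : radical y -> exists z, y + z + y ** z = 0.
Proof.
move=> ry; have [z zE] := radical_left_quasiregular ry.
have /eqP : z + (y + z ** y) = 0 by rewrite addrA.
rewrite addr_eq0 => /eqP zE'.
have rz : radical z.
  by rewrite zE'; apply: radicalN; apply: radicalD; [|exact: radicalMl].
have [t tE] := radical_left_quasiregular rz; exists z.
suff -> : y = t by [].
have := circA t z y; rewrite /circ zE tE.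
by rewrite rng0r rng0l !(add0r, addr0) => <-. 
Qed.

End Radical.

(** * A ring with zero radical is semiprimitive *)

Section Semiprimitivity.
Variable R : rngType.

Definition cosimple_ideal := {N : set R | `[< cosimple N >]}.
HB.instance Definition _ := Choice.on cosimple_ideal.
Implicit Types (i j : cosimple_ideal) (a b : R).

Lemma cosimple_idealP i : cosimple (val i).
Proof. exact/asboolP/(valP i). Qed.

Lemma cosimple_ideal_left i : left_ideal (val i).
Proof. by case: (cosimple_idealP i). Qed.

(** The choice is made from the coset as a set, so congruent elements receive equal representatives;
    these stand for the elements of R / N. *)
Definition coset_repr i a : R := xget 0 [set b | val i (a - b)].

Lemma coset_reprP i a : val i (a - coset_repr i a).
Proof.
apply: (@xgetPex _ 0 [set b | val i (a - b)]); exists a => /=.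
by rewrite subrr; case: (cosimple_ideal_left i).
Qed.

Lemma eq_coset_repr i a b : coset_repr i a = coset_repr i b <-> val i (a - b).
Proof.
have li := cosimple_ideal_left i; split=> [ab|ab].
  have -> : a - b = (a - coset_repr i a) - (b - coset_repr i b).
    by rewrite opprB addrA -ab subrK.
  by case: li => _ + _; apply; exact: coset_reprP.
congr xget; apply/seteqP; split=> c /= ac; case: (li) => _ sub _.
  have -> : b - c = a - c - (a - b) by rewrite opprB [RHS]addrC subrKA.
  exact: sub.
by rewrite -(subrKA b); apply: left_idealD.
Qed.

Lemma coset_repr_id i a : coset_repr i (coset_repr i a) = coset_repr i a.
Proof.
apply/eq_coset_repr; rewrite -opprB; apply: left_idealN (coset_reprP i a).
exact: cosimple_ideal_left.
Qed.

Lemma coset_reprDl i a b : coset_repr i (coset_repr i a + b) = coset_repr i (a + b).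
Proof.
apply/eq_coset_repr; rewrite opprD addrACA subrr addr0.
exact/eq_coset_repr/coset_repr_id.
Qed.

Lemma coset_reprDr i a b : coset_repr i (a + coset_repr i b) = coset_repr i (a + b).
Proof. by rewrite addrC coset_reprDl addrC. Qed.

Lemma coset_reprN i a : coset_repr i (- coset_repr i a) = coset_repr i (- a).
Proof.
by apply/eq_coset_repr; rewrite opprK addrC; exact: coset_reprP.
Qed.

Lemma coset_reprM i a b : coset_repr i (a ** coset_repr i b) = coset_repr i (a ** b).
Proof.
apply/eq_coset_repr; rewrite -rngBr; case: (cosimple_ideal_left i) => _ _; apply.
by apply/eq_coset_repr/coset_repr_id.
Qed.

(* The direct sum of the modules R / N, with cosets represented by canonical
   elements. *)
Definition is_coset_family (f : cosimple_ideal -> R) :=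
  (forall i, f i = coset_repr i (f i)) /\
  finite_set [set i | f i <> coset_repr i 0].

Definition coset_family := {f : cosimple_ideal -> R | `[< is_coset_family f >]}.
HB.instance Definition _ := Choice.on coset_family.

Lemma coset_familyP (f : coset_family) : is_coset_family (val f).
Proof. exact/asboolP/(valP f). Qed.

Lemma coset_family_reprE (f : coset_family) i :
  coset_repr i (val f i) = val f i.
Proof. by case: (coset_familyP f) => ->; rewrite coset_repr_id. Qed.

Lemma coset_familyE (f g : coset_family) :
  (forall i, val f i = val g i) -> f = g.
Proof. by move=> fg; apply/val_inj/funext. Qed.

Lemma coset_repr0 i a : coset_repr i a = coset_repr i 0 <-> val i a.
Proof. by rewrite eq_coset_repr subr0. Qed.

(** The support condition concerns raw values, which are normalised afterwards; this lets the
    operations be written as plain formulas in R. *)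
Definition mk_coset_family (f : cosimple_ideal -> R)
    (ff : finite_set [set i | ~ val i (f i)]) : coset_family.
Proof.
exists (fun i => coset_repr i (f i)); apply/asboolP; split=> [i|].
  by rewrite coset_repr_id.
apply: sub_finite_set ff => i /= + fi; apply; exact/coset_repr0.
Defined.

Lemma coset_family_supp (f : coset_family) :
  finite_set [set i | ~ val i (val f i)].
Proof.
have [_ ff] := coset_familyP f; apply: sub_finite_set ff => i /= + fi; apply.
rewrite -(subr0 (val f i)); apply/eq_coset_repr.
by rewrite coset_family_reprE; exact: fi.
Qed.

Let coset_family_ind (f g : coset_family) (h : forall i, R) :
  (forall i, val i (val f i) -> val i (val g i) -> val i (h i)) ->
  finite_set [set i | ~ val i (h i)].
Proof.
move=> fgh.
apply: (@sub_finite_set _ _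
  ([set i | ~ val i (val f i)] `|` [set i | ~ val i (val g i)])).
  move=> i /= nh; apply: contrapT => /not_orP[/contrapT fi /contrapT gi].
  by apply: nh; exact: fgh.
by rewrite finite_setU; split; exact: coset_family_supp.
Qed.

Lemma coset_family_add_fin (f g : coset_family) :
  finite_set [set i | ~ val i (val f i + val g i)].
Proof.
apply: (@coset_family_ind f g) => i fi gi; apply: left_idealD => //.
exact: cosimple_ideal_left.
Qed.

Lemma coset_family_opp_fin (f : coset_family) :
  finite_set [set i | ~ val i (- val f i)].
Proof.
apply: (@coset_family_ind f f) => i fi _; apply: left_idealN => //.
exact: cosimple_ideal_left.
Qed.

Lemma coset_family_act_fin a (f : coset_family) :
  finite_set [set i | ~ val i (a ** val f i)].
Proof.
apply: (@coset_family_ind f f) => i fi _; case: (cosimple_ideal_left i) => _ _.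
exact.
Qed.

Lemma coset_family_zero_fin : finite_set [set i : cosimple_ideal | ~ val i 0].
Proof.
rewrite [X in finite_set X](_ : _ = set0) //; apply/seteqP; split=> // i.
by apply; case: (cosimple_ideal_left i).
Qed.

Lemma coset_family_single_fin i a :
  finite_set [set j | ~ val j (if j == i then a else 0)].
Proof.
apply: sub_finite_set (finite_set1 i) => j /=; case: eqP => // _.
by case; case: (cosimple_ideal_left j).
Qed.

Definition coset_family_add f g := mk_coset_family (coset_family_add_fin f g).
Definition coset_family_opp f := mk_coset_family (coset_family_opp_fin f).
Definition coset_family_zero := mk_coset_family coset_family_zero_fin.
Definition coset_family_act a f := mk_coset_family (coset_family_act_fin a f).
Definition single i a := mk_coset_family (coset_family_single_fin i a).

Fact coset_family_addA : associative coset_family_add.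
Proof.
by move=> f g h; apply: coset_familyE => i /=; rewrite coset_reprDl coset_reprDr addrA.
Qed.

Fact coset_family_addC : commutative coset_family_add.
Proof. by move=> f g; apply: coset_familyE => i /=; rewrite addrC. Qed.

Fact coset_family_add0 : left_id coset_family_zero coset_family_add.
Proof.
move=> f; apply: coset_familyE => i /=.
by rewrite coset_reprDl add0r coset_family_reprE.
Qed.

Fact coset_family_addN :
  left_inverse coset_family_zero coset_family_opp coset_family_add.
Proof.
by move=> f; apply: coset_familyE => i /=; rewrite coset_reprDl addNr.
Qed.

HB.instance Definition _ := GRing.isZmodule.Build coset_family
  coset_family_addA coset_family_addC coset_family_add0 coset_family_addN.

Fact coset_family_actA a b (f : coset_family) :
  coset_family_act (a ** b) f = coset_family_act a (coset_family_act b f).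
Proof. by apply: coset_familyE => i /=; rewrite coset_reprM rngmulA. Qed.

Fact coset_family_actDl a b (f : coset_family) :
  coset_family_act (a + b) f = coset_family_act a f + coset_family_act b f.
Proof.
by apply: coset_familyE => i /=; rewrite coset_reprDl coset_reprDr rngmulDl.
Qed.

Fact coset_family_actDr a (f g : coset_family) :
  coset_family_act a (f + g) = coset_family_act a f + coset_family_act a g.
Proof.
by apply: coset_familyE => i /=; rewrite coset_reprM coset_reprDl coset_reprDr rngmulDr.
Qed.

Definition coset_module :=
  RngModule coset_family_actA coset_family_actDl coset_family_actDr.

Lemma coset_family_zeroP (f : coset_family) : f = 0 <-> forall i, val i (val f i).
Proof.
split=> [-> i|f0].
  by apply/coset_repr0; rewrite coset_repr_id.
by apply: coset_familyE => i; rewrite -coset_family_reprE; exact/coset_repr0.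
Qed.

Lemma val_single i a : val (single i a) i = coset_repr i a.
Proof. by rewrite /= eqxx. Qed.

Definition component i : set coset_module :=
  [set f | forall j, j != i -> val j (val f j)].

Lemma component_single i a : component i (single i a).
Proof.
by move=> j /negbTE ji; apply/coset_repr0; rewrite /= ji coset_repr_id.
Qed.

Lemma componentE i (f : coset_module) : component i f -> f = single i (val f i).
Proof.
move=> fi; apply: coset_familyE => j /=; case: eqP => [->|/eqP ji].
  by rewrite coset_family_reprE.
by rewrite -coset_family_reprE; apply/coset_repr0/fi.
Qed.

Lemma component_submodule i : is_submodule (component i).
Proof.
split=> [j _|f g fi gi j ji|a f fi j ji].
- exact: ((coset_family_zeroP 0).1 erefl j).
- have lj := cosimple_ideal_left j; apply/coset_repr0.
  rewrite coset_repr_id coset_reprDr; apply/coset_repr0.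
  by case: lj => _ + _; apply; [exact: fi | exact: gi].
- apply/coset_repr0; rewrite coset_repr_id; apply/coset_repr0.
  by case: (cosimple_ideal_left j) => _ _; apply; exact: fi.
Qed.

Lemma singleB i a b : single i (a - b) = single i a - single i b.
Proof.
apply: coset_familyE => j /=; rewrite coset_reprDl coset_reprDr.
by rewrite -[RHS]coset_reprDr coset_reprN coset_reprDr; case: eqP; rewrite ?subr0.
Qed.

Lemma singleM i a b : single i (a ** b) = coset_family_act a (single i b).
Proof.
by apply: coset_familyE => j /=; rewrite coset_reprM; case: eqP; rewrite ?rng0r.
Qed.

Lemma single_eq0 i a : single i a = 0 <-> val i a.
Proof.
split=> [/coset_family_zeroP/(_ i)|ia].
  by rewrite -coset_repr0 val_single coset_repr_id coset_repr0.
apply/coset_family_zeroP => j; apply/coset_repr0; rewrite coset_repr_id.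
by apply/coset_repr0; case: eqP => [->//|_]; case: (cosimple_ideal_left j).
Qed.

(** Pulling a submodule back along [single i] gives a left ideal containing [val i], and maximality
    leaves only [val i] and the whole ring. *)
Lemma component_simple i : is_simple_submodule (component i).
Proof.
have [_ [a [b nab]] imax] := cosimple_idealP i.
split; first exact: component_submodule.
  exists a, (single i b); split; first exact: component_single.
  by rewrite /= -singleM => /single_eq0.
move=> N' [N'0 N'B N'M] N'i.
pose L := [set c | N' (single i c)].
have [|c ic|LE|LE] := imax L.
- split=> [|c d Lc Ld|c d Ld]; rewrite /L /=.
  + suff -> : single i 0 = 0 by [].
    by apply/single_eq0; case: (cosimple_ideal_left i).
  + by rewrite singleB; exact: N'B.
  + by rewrite singleM; exact: N'M.
- by rewrite /L /= (_ : single i c = 0) //; exact/single_eq0.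
- left; apply/seteqP; split=> [f N'f|f -> //] /=.
  have fE := componentE (N'i _ N'f); rewrite fE; apply/single_eq0.
  by rewrite -LE /L /= -fE.
- right; apply/seteqP; split=> // f fi; rewrite (componentE fi).
  by have : setT (val f i) by []; rewrite -LE.
Qed.

Lemma coset_family_sumE (F : cosimple_ideal -> coset_module) i :
  (forall j, component j (F j)) -> finite_set [set j | F j <> 0] ->
  val (\sum_(j \in [set: cosimple_ideal]) F j : coset_module) i = val (F i) i.
Proof.
move=> Fc Ffin; set S := fset_set [set j | F j <> 0].
(* Adding i to the support allows its summand to be split off even when [F i] is 0. *)
rewrite (@fsbigTE _ _ _ _ (i |` S)%fset) => [|j]; last first.
  rewrite in_fset1U negb_or => /andP[_]; rewrite in_fset_set //= notin_setE /=.
  exact: contrapT.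
rewrite (bigD1_seq i) ?fset_uniq ?fset1U1 //=.
set T := \sum_(j <- _ | _) _.
suff Ti : val i (val T i).
  change (coset_repr i (val (F i) i + val T i) = val (F i) i).
  rewrite -coset_reprDr ((coset_repr0 _ _).2 Ti) coset_reprDr addr0.
  exact: coset_family_reprE.
rewrite {}/T; elim/big_ind: _ => [|f g fi gi|j ji].
- exact: ((coset_family_zeroP 0).1 erefl i).
- apply/coset_repr0; rewrite coset_repr_id; apply/coset_repr0.
  by apply: left_idealD => //; exact: cosimple_ideal_left.
- by apply: Fc; rewrite eq_sym.
Qed.

(** If a acts by zero, it sends the coset of each b in each R / N to zero, which is membership in
    the radical. *)
Lemma semiprimitive_radical0 : (forall a : R, radical a -> a = 0) -> semiprimitive R.
Proof.
move=> rad0; exists coset_module; split.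
  move=> a a0; apply: rad0 => N sN b.
  have sNb : `[< cosimple N >] by exact/asboolP.
  by have := a0 (single (exist _ N sNb) b); rewrite /= -singleM => /single_eq0.
exists cosimple_ideal, component; split; first exact: component_simple.
move=> f; have fin : finite_set [set i | single i (val f i) <> 0].
  by apply: sub_finite_set (coset_family_supp f) => i /= + fi; apply; apply/single_eq0.
exists (fun i => single i (val f i)); split.
  split=> // [i|]; first exact: component_single.
  apply: coset_familyE => i; rewrite coset_family_sumE //; last first.
    by move=> j; exact: component_single.
  by rewrite val_single coset_family_reprE.
move=> F [Fc Ffin ->]; apply/funext => i.
by rewrite coset_family_sumE // -componentE.
Qed.

End Semiprimitivity.

(** * A Z-graded representation *)

(* A substitute for the boundary path space: (v, n) plays the role of a path
   starting at v, and is either an edge followed by another such path, or, only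
   at a sink, the empty path. *)
Record branching (G : ultragraph) := Branching {
  branch_head : vertex G * nat -> option (edge G * (vertex G * nat));
  branch_cons : edge G -> vertex G * nat -> vertex G * nat;
  branch_consK : forall e y, edge_range e y.1 ->
    branch_head (branch_cons e y) = Some (e, y);
  branch_headP : forall x e y, branch_head x = Some (e, y) ->
    [/\ x.1 = edge_source e, edge_range e y.1 & branch_cons e y = x];
  branch_sink : forall x, branch_head x = None -> out_edges x.1 = set0
}.

(** When v emits an edge, the pairs (e, y) with e leaving v and y lying over r(e) form a countably
    infinite set: infinite because of the factor [nat] and because r(e) is nonempty. They can
    therefore be matched bijectively with the points (v, n). *)
Lemma branching_exists (G : ultragraph) : $|branching G|.
Proof.
pose B v := [set t : edge G * (vertex G * nat) |
  edge_source t.1 = v /\ edge_range t.1 t.2.1].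
have Bnat v : exists h : _ -> nat, out_edges v !=set0 -> set_bij (B v) [set: nat] h.
  have [[e ev]|nv] := pselect (out_edges v !=set0); last by exists (fun=> 0%N).
  have [w ew] := edge_range_neq0 e.
  suff /card_set_bijP[h hB] : (B v #= [set: nat])%card by exists h.
  apply: eq_card_nat; first exact: countableP.
  move=> /(finite_image (fun t => t.2.2)); apply: contra_not infinite_nat.
  by apply: sub_finite_set => n _; exists (e, (w, n)).
have {Bnat} [h hB] := choice Bnat.
pose head (x : vertex G * nat) :=
  if pselect (exists t, B x.1 t /\ h x.1 t = x.2) is left ht
  then Some (sval (cid ht)) else None.
pose cons e (y : vertex G * nat) := (edge_source e, h (edge_source e) (e, y)).
have headP x t : head x = Some t -> B x.1 t /\ h x.1 t = x.2.
  by rewrite /head; case: pselect => // ht [<-]; case: cid.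
split; exists head cons.
- move=> e y ey; have Bey : B (edge_source e) (e, y) by [].
  case E : (head _) => [t|].
    have [/= Bt ht] := headP _ _ E; congr Some.
    have [_ hinj _] : set_bij (B (edge_source e)) setT (h (edge_source e)).
      by apply: hB; exists e.
    by apply: hinj => //; rewrite inE.
  by move: E; rewrite /head; case: pselect => // -[]; exists (e, y).
- move=> x e y /headP[[/= ex ey] hx]; split=> //.
  by rewrite /cons ex hx -surjective_pairing.
- move=> x; rewrite /head; case: pselect => // nx _; apply/seteqP; split=> // e ex.
  have [_ _ hsurj] : set_bij (B x.1) setT (h x.1) by apply: hB; exists e.
  by apply: nx; have [t Bt ht] := hsurj x.2 I; exists t.
Qed.

Section Representation.
Variables (K : fieldType) (G : ultragraph) (br : branching G).

Notation point := (vertex G * nat)%type.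
Notation V := (point -> int -> K^o).
Implicit Types (t : lterm K G) (f g : V).

(* The integer is a degree, which edges raise by one and ghost edges lower by
   one. *)
Fixpoint term_act t f : V :=
  match t with
  | lproj A _ => fun x d => if `[< A x.1 >] then f x d else 0
  | ledge e => fun x d =>
      if branch_head br x is Some (e', y)
      then if e' == e then f y (d - 1) else 0 else 0
  | lghost e => fun x d =>
      if `[< edge_range e x.1 >] then f (branch_cons br e x) (d + 1) else 0
  | lzero => 0
  | lopp t => - term_act t f
  | ladd t u => term_act t f + term_act u f
  | lscale k t => k *: term_act t f
  | lmul t u => term_act t (term_act u f)
  end.

Lemma term_actD t f g : term_act t (f + g) = term_act t f + term_act t g.
Proof.
elim: t f g => [A gA|e|e||t IH|t IHt u IHu|k t IH|t IHt u IHu] f g /=.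
- by apply/funext => x; apply/funext => d; rewrite !fctE; case: ifP; rewrite ?addr0.
- apply/funext => x; apply/funext => d; rewrite !fctE.
  by case: branch_head => [[e' y]|]; rewrite ?addr0//; case: ifP; rewrite ?addr0.
- by apply/funext => x; apply/funext => d; rewrite !fctE; case: ifP; rewrite ?addr0.
- by rewrite addr0.
- by rewrite IH opprD.
- by rewrite IHt IHu addrACA.
- by rewrite IH scalerDr.
- by rewrite IHu IHt.
Qed.

Lemma term_actZ t k f : term_act t (k *: f) = k *: term_act t f.
Proof.
elim: t f => [A gA|e|e||t IH|t IHt u IHu|l t IH|t IHt u IHu] f /=.
- by apply/funext => x; apply/funext => d; rewrite !fctE; case: ifP; rewrite ?scaler0.
- apply/funext => x; apply/funext => d; rewrite !fctE.
  by case: branch_head => [[e' y]|]; rewrite ?scaler0//; case: ifP; rewrite ?scaler0.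
- by apply/funext => x; apply/funext => d; rewrite !fctE; case: ifP; rewrite ?scaler0.
- by rewrite scaler0.
- by rewrite IH scalerN.
- by rewrite IHt IHu scalerDr.
- by rewrite IH !scalerA mulrC.
- by rewrite IHu IHt.
Qed.

Lemma term_act_sum (I : Type) (r : seq I) (F : I -> lterm K G) f :
  term_act (\big[@ladd K G/@lzero K G]_(i <- r) F i) f = \sum_(i <- r) term_act (F i) f.
Proof. by elim: r => [|i r IH]; rewrite ?big_nil ?big_cons//= IH. Qed.

(** This makes the action descend to the algebra. For relation (4), a point over a regular vertex
    begins with exactly one edge ([branch_sink] excludes the empty path there), so exactly one
    summand acts on it, as the identity. *)
Lemma term_act_lequiv t u : lequiv t u -> term_act t = term_act u.
Proof.
elim=> {t u} [//|t u _ ->//|t u v _ -> _ -> //|t u _ IH|t t' u u' _ IHt _ IHu|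
  k t u _ IH|t t' u u' _ IHt _ IHu|t u v|t u|t|t|a b t|t|a t u|a b t|t u v|t u v
  |t u v|a t u|a t u||A B gA gB|A B gA gB|e|e|e|e|e|e e' ee'|v [vne vfin]];
  apply/funext => f //=.
- by rewrite IH.
- by rewrite IHt IHu.
- by rewrite IH.
- by rewrite IHt IHu.
- by rewrite addrA.
- by rewrite addrC.
- by rewrite add0r.
- by rewrite addNr.
- by rewrite scalerA.
- by rewrite scale1r.
- by rewrite scalerDr.
- by rewrite scalerDl.
- by rewrite term_actD.
- by rewrite term_actZ.
- apply/funext => x; apply/funext => d; case: ifP => // /asboolP //.
- apply/funext => x; apply/funext => d; rewrite asbool_and.
  by case: ifP.
- apply/funext => x; apply/funext => d; rewrite !fctE.
  have -> : `[< (A `|` B) x.1 >] = `[< A x.1 >] || `[< B x.1 >] by exact: asbool_or.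
  have -> : `[< (A `&` B) x.1 >] = `[< A x.1 >] && `[< B x.1 >] by exact: asbool_and.
  by do 2 case: `[< _ >] => //=; rewrite ?(addrK, oppr0, addr0, add0r).
- apply/funext => x; apply/funext => d.
  case: ifP => // /asboolP xe; case xE: branch_head => [[e' y]|] //.
  by case: eqP => // e'e; have [+ _ _] := branch_headP xE; rewrite e'e => /xe.
- apply/funext => x; apply/funext => d.
  case xE: branch_head => [[e' y]|] //; case: eqP => // e'e.
  by have [_ + _] := branch_headP xE; rewrite e'e => /asboolP ->.
- by apply/funext => x; apply/funext => d; case: `[< _ >].
- apply/funext => x; apply/funext => d.
  case: (asboolP (edge_range e x.1)) => // /(branch_consK br) eE.
  by have [-> _ _] := branch_headP eE; rewrite asboolT.
- apply/funext => x; apply/funext => d.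
  case: (asboolP (edge_range e x.1)) => // /(branch_consK br) ->.
  by rewrite eqxx addrK.
- apply/funext => x; apply/funext => d.
  case: (asboolP (edge_range e x.1)) => // /(branch_consK br) ->.
  by case: eqP.
- rewrite term_act_sum; apply/funext => x; apply/funext => d.
  rewrite !fct_sumE /=.
  case xE: branch_head => [[e y]|]; last first.
    rewrite big1 //; case: ifP => // /asboolP /= xv.
    by have [e ev] := vne; have := branch_sink xE; rewrite xv => /seteqP[/(_ _ ev)].
  have [x1 ye xy] := branch_headP xE.
  case: ifP => [/asboolP /= xv|/asboolP xv].
    rewrite (bigD1_seq e) ?fset_uniq //=; last first.
      by rewrite in_fset_set // inE /out_edges /= -x1.
    rewrite eqxx ifT; last exact/asboolP.
    rewrite xy subrK big1 ?addr0 // => e' /negbTE e'e.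
    by rewrite eq_sym e'e.
  rewrite big_seq big1 // => e'; rewrite in_fset_set // inE => /= e'v.
  by case: eqP => // ee'; case: xv; rewrite /= x1 ee'.
Qed.

End Representation.

(** * Reduction to path polynomials *)

Section Generators.
Variables (K : fieldType) (G : ultragraph).
Notation L := (leavitt K G).
Implicit Types (A B : set (vertex G)) (v w : vertex G) (e : edge G) (x y : L).

(* Extended by 0 to the sets that are not generalized vertices. *)
Definition gproj A : L :=
  if pselect (genvertex A) is left gA then lclass (lproj K gA) else 0.
Definition sedge e : L := lclass (ledge K e).
Definition sghost e : L := lclass (lghost K e).
Definition vproj v : L := gproj [set v].

Lemma gprojE A (gA : genvertex A) : gproj A = lclass (lproj K gA).
Proof. by rewrite /gproj; case: pselect => // gA'; rewrite (Prop_irrelevance gA' gA). Qed.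

Lemma gproj_set0 : gproj set0 = 0.
Proof. by rewrite (gprojE (@genvertex0 G)) -lclass0; apply/lclassP/lequiv_p0. Qed.

Lemma gprojI A B : genvertex A -> genvertex B -> gproj A ** gproj B = gproj (A `&` B).
Proof.
move=> gA gB; rewrite (gprojE gA) (gprojE gB) (gprojE (genvertexI gA gB)) -lclassM.
exact/lclassP/lequiv_pI.
Qed.

Lemma gprojU A B : genvertex A -> genvertex B ->
  gproj (A `|` B) = gproj A + gproj B - gproj (A `&` B).
Proof.
move=> gA gB.
rewrite (gprojE gA) (gprojE gB) (gprojE (genvertexI gA gB)) (gprojE (genvertexU gA gB)).
by rewrite -lclassN -!lclassD; apply/lclassP/lequiv_pU.
Qed.

Lemma vproj_sedge e : vproj (edge_source e) ** sedge e = sedge e.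
Proof.
by rewrite /vproj (gprojE (genvertex1 _)) -lclassM; apply/lclassP/lequiv_ps.
Qed.

Lemma sedge_range e : sedge e ** gproj (edge_range e) = sedge e.
Proof. by rewrite (gprojE (genvertex_range _)) -lclassM; apply/lclassP/lequiv_sp. Qed.

Lemma range_sghost e : gproj (edge_range e) ** sghost e = sghost e.
Proof. by rewrite (gprojE (genvertex_range _)) -lclassM; apply/lclassP/lequiv_pg. Qed.

Lemma sghost_vproj e : sghost e ** vproj (edge_source e) = sghost e.
Proof.
by rewrite /vproj (gprojE (genvertex1 _)) -lclassM; apply/lclassP/lequiv_gp.
Qed.

Lemma sghost_sedge e : sghost e ** sedge e = gproj (edge_range e).
Proof. by rewrite (gprojE (genvertex_range _)) -lclassM; apply/lclassP/lequiv_gs_eq. Qed.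

Lemma sghost_sedge_neq e e' : e <> e' -> sghost e ** sedge e' = 0.
Proof. by move=> ee'; rewrite -lclassM -lclass0; apply/lclassP/lequiv_gs_neq. Qed.

Lemma vproj_regular v : regular v ->
  vproj v = \sum_(e <- fset_set (out_edges v)) sedge e ** sghost e.
Proof.
move=> rv; rewrite /vproj (gprojE (genvertex1 v)).
under eq_bigr do rewrite -lclassM; rewrite -lclass_sum.
exact/lclassP/lequiv_sg.
Qed.

Lemma gproj_vproj A v : genvertex A ->
  gproj A ** vproj v = if `[< A v >] then vproj v else 0.
Proof.
move=> gA; rewrite gprojI //; last exact: genvertex1.
case: asboolP => Av; last rewrite -gproj_set0.
  by congr gproj; apply/seteqP; split=> [u []|u /= ->].
by congr gproj; apply/seteqP; split=> [u /= [Au uv]|//]; apply: Av; rewrite -uv.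
Qed.

Lemma vproj_gproj A v : genvertex A ->
  vproj v ** gproj A = if `[< A v >] then vproj v else 0.
Proof.
move=> gA; rewrite -gproj_vproj // /vproj !gprojI ?(setIC A) //; exact: genvertex1.
Qed.

Lemma gproj_sedge A e : genvertex A ->
  gproj A ** sedge e = if `[< A (edge_source e) >] then sedge e else 0.
Proof.
move=> gA; rewrite -vproj_sedge rngmulA gproj_vproj //.
by case: ifP => _ //; rewrite rng0l.
Qed.

Lemma sghost_gproj A e : genvertex A ->
  sghost e ** gproj A = if `[< A (edge_source e) >] then sghost e else 0.
Proof.
move=> gA; rewrite -sghost_vproj -rngmulA vproj_gproj //.
by case: ifP => _ //; rewrite rng0r.
Qed.

Lemma vproj_id v : vproj v ** vproj v = vproj v.
Proof. by rewrite gproj_vproj ?asboolT //; exact: genvertex1. Qed.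

Lemma leavitt_ind (P : L -> Prop) :
  (forall A, genvertex A -> P (gproj A)) -> (forall e, P (sedge e)) ->
  (forall e, P (sghost e)) -> P 0 ->
  (forall x y, P x -> P y -> P (x + y)) -> (forall k x, P x -> P (k *: x)) ->
  (forall x y, P x -> P y -> P (x ** y)) -> forall x, P x.
Proof.
move=> Pp Ps Pg P0 PD PZ PM x; rewrite -(reprlK x).
elim: (repr x) => [A gA|e|e||t IH|t IHt u IHu|k t IH|t IHt u IHu].
- by rewrite -gprojE; exact: Pp.
- exact: Ps.
- exact: Pg.
- exact: P0.
- by rewrite lclassN -scaleN1r; exact: PZ.
- by rewrite lclassD; exact: PD.
- by rewrite lclassZ; exact: PZ.
- by rewrite lclassM; exact: PM.
Qed.

(* Inclusion-exclusion: B \ C need not be a generalized vertex, but its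
   indicator function still has a counterpart in the algebra. *)
Definition dproj B C : L := gproj B - gproj (B `&` C).

(** A cuts B \ C into a part inside A and a part outside. *)
Lemma dproj_split A B C : genvertex A -> genvertex B -> genvertex C ->
  dproj B C = dproj (A `&` B) C + dproj B (A `|` C).
Proof.
move=> gA gB gC; rewrite /dproj.
have -> : B `&` (A `|` C) = (A `&` B) `|` (B `&` C) by rewrite setIUr (setIC A).
rewrite gprojU; [|exact: genvertexI|exact: genvertexI].
have -> : (A `&` B) `&` (B `&` C) = A `&` B `&` C.
  by apply/seteqP; split=> v /=; tauto.
rewrite opprB opprD addrA addrACA subrK [RHS]addrC.
by rewrite -!addrA (addrC (- _)) addrK -?addrA ?addrA.
Qed.

End Generators.

(** * The algebra acting on graded functions; degree bounds *)

Section Action.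
Variables (K : fieldType) (G : ultragraph) (br : branching G).
Notation L := (leavitt K G).
Notation point := (vertex G * nat)%type.
Notation V := (point -> int -> K^o).
Implicit Types (x y : L) (f g : V) (A B : set (vertex G)) (e : edge G) (w v : vertex G).

Definition lact x f : V := term_act br (repr x) f.

Lemma lact_class t f : lact (lclass t) f = term_act br t f.
Proof. by rewrite /lact (term_act_lequiv br (lequiv_repr t)). Qed.

Lemma lact0 f : lact 0 f = 0.
Proof. by rewrite -lclass0 lact_class. Qed.

Lemma lactD x y f : lact (x + y) f = lact x f + lact y f.
Proof. by rewrite -(reprlK x) -(reprlK y) -lclassD !lact_class. Qed.

Lemma lactZ k x f : lact (k *: x) f = k *: lact x f.
Proof. by rewrite -(reprlK x) -lclassZ !lact_class. Qed.

Lemma lactM x y f : lact (x ** y) f = lact x (lact y f).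
Proof. by rewrite -(reprlK x) -(reprlK y) -lclassM !lact_class. Qed.

Lemma lact_sum (I : Type) (r : seq I) (F : I -> L) f :
  lact (\sum_(i <- r) F i) f = \sum_(i <- r) lact (F i) f.
Proof. by apply: (big_morph (lact^~ f)) => [x y|]; rewrite ?lactD ?lact0. Qed.

Lemma lactDr x f g : lact x (f + g) = lact x f + lact x g.
Proof. exact: term_actD. Qed.

Lemma lact0r x : lact x 0 = 0.
Proof. by apply: (addrI (lact x 0)); rewrite -lactDr !addr0. Qed.

Lemma lact_gproj A f p d : genvertex A ->
  lact (gproj K A) f p d = if `[< A p.1 >] then f p d else 0.
Proof. by move=> gA; rewrite (gprojE K gA) lact_class. Qed.

Lemma lact_sedge e f p d : lact (sedge K e) f p d =
  if branch_head br p is Some (e', q) then if e' == e then f q (d - 1) else 0 else 0.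
Proof. by rewrite lact_class. Qed.

Lemma lact_sghost e f p d : lact (sghost K e) f p d =
  if `[< edge_range e p.1 >] then f (branch_cons br e p) (d + 1) else 0.
Proof. by rewrite lact_class. Qed.

Lemma lact_vproj v f p d :
  lact (vproj K v) f p d = if p.1 == v then f p d else 0.
Proof.
rewrite lact_gproj; last exact: genvertex1.
by congr (if _ then _ else _); apply/asboolP/eqP.
Qed.

Definition basepoint v : V :=
  fun p d => if (p == (v, 0%N)) && (d == 0) then 1 else 0.

Lemma vproj_basepoint v : lact (vproj K v) (basepoint v) = basepoint v.
Proof.
apply/funext => p; apply/funext => d; rewrite lact_vproj /basepoint.
by case: (p =P (v, 0%N)) => [->|_]; rewrite ?eqxx //= if_same.
Qed.

Definition lower_bounded m f := forall p d, d < m -> f p d = 0.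
Definition upper_bounded m f := forall p d, m < d -> f p d = 0.
Definition top_degree m f := upper_bounded m f /\ exists p, f p m != 0.

Lemma basepoint_top v : top_degree 0 (basepoint v).
Proof.
split; last by exists (v, 0%N); rewrite /basepoint !eqxx oner_neq0.
by move=> p d; rewrite /basepoint; case: (d =P 0) => [->|]; rewrite ?ltxx // andbF.
Qed.

Lemma basepoint_lower v : lower_bounded 0 (basepoint v).
Proof.
by move=> p d; rewrite /basepoint; case: (d =P 0) => [->|]; rewrite ?ltxx // andbF.
Qed.

Lemma top_degree_neq0 m f : top_degree m f -> f <> 0.
Proof. by move=> [_ [p /eqP fp]] f0; apply: fp; rewrite f0. Qed.

Lemma vproj_neq0 v : vproj K v <> 0.
Proof.
move=> v0; apply: (top_degree_neq0 (basepoint_top v)).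
by rewrite -vproj_basepoint v0 lact0.
Qed.

Lemma sedge_lower m e f :
  lower_bounded m f -> lower_bounded (m + 1) (lact (sedge K e) f).
Proof.
move=> fm p d dm; rewrite lact_sedge; case: branch_head => [[e' q]|] //.
by case: ifP => // _; apply: fm; rewrite ltrBlDr.
Qed.

Lemma sedge_upper m e f :
  upper_bounded m f -> upper_bounded (m + 1) (lact (sedge K e) f).
Proof.
move=> fm p d dm; rewrite lact_sedge; case: branch_head => [[e' q]|] //.
by case: ifP => // _; apply: fm; rewrite ltrBrDr.
Qed.

Lemma lower_boundedD m f g :
  lower_bounded m f -> lower_bounded m g -> lower_bounded m (f + g).
Proof. by move=> fm gm p d dm; rewrite !fctE fm // gm // addr0. Qed.

Lemma upper_boundedD m f g :
  upper_bounded m f -> upper_bounded m g -> upper_bounded m (f + g).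
Proof. by move=> fm gm p d dm; rewrite !fctE fm // gm // addr0. Qed.

Lemma lower_boundedZ m k f : lower_bounded m f -> lower_bounded m (k *: f).
Proof. by move=> fm p d dm; rewrite !fctE fm // scaler0. Qed.

Lemma upper_boundedZ m k f : upper_bounded m f -> upper_bounded m (k *: f).
Proof. by move=> fm p d dm; rewrite !fctE fm // scaler0. Qed.

Lemma gproj_lower A m f : genvertex A ->
  lower_bounded m f -> lower_bounded m (lact (gproj K A) f).
Proof. by move=> gA fm p d dm; rewrite lact_gproj // fm // if_same. Qed.

Lemma gproj_upper A m f : genvertex A ->
  upper_bounded m f -> upper_bounded m (lact (gproj K A) f).
Proof. by move=> gA fm p d dm; rewrite lact_gproj // fm // if_same. Qed.

Lemma lower_boundedW m m' f : m' <= m -> lower_bounded m f -> lower_bounded m' f.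
Proof. by move=> mm' fm p d dm; apply: fm; exact: lt_le_trans mm'. Qed.

Lemma upper_boundedW m m' f : m <= m' -> upper_bounded m f -> upper_bounded m' f.
Proof. by move=> mm' fm p d dm; apply: fm; exact: le_lt_trans dm. Qed.

Lemma sghost_lower m e f :
  lower_bounded m f -> lower_bounded (m - 1) (lact (sghost K e) f).
Proof.
move=> fm p d dm; rewrite lact_sghost; case: ifP => // _; apply: fm.
by rewrite -ltrBrDr.
Qed.

Lemma sghost_upper m e f :
  upper_bounded m f -> upper_bounded (m - 1) (lact (sghost K e) f).
Proof.
move=> fm p d dm; rewrite lact_sghost; case: ifP => // _; apply: fm.
by rewrite -ltrBlDr.
Qed.

Definition bounded f := exists a b, lower_bounded a f /\ upper_bounded b f.

(** Arbitrary functions of the degree are allowed in V. This guarantees top and bottom degrees for a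
    nonzero vector obtained by applying an unknown element, such as a quasi-inverse, to a
    basepoint. *)
Lemma lact_bounded x f : bounded f -> bounded (lact x f).
Proof.
elim/leavitt_ind: x f => [A gA|e|e||x y IHx IHy|k x IH|x y IHx IHy] f.
- move=> [a [b [fa fb]]]; exists a, b.
  by split; [exact: gproj_lower | exact: gproj_upper].
- move=> [a [b [fa fb]]]; exists (a + 1), (b + 1).
  by split; [exact: sedge_lower | exact: sedge_upper].
- move=> [a [b [fa fb]]]; exists (a - 1), (b - 1).
  by split; [exact: sghost_lower | exact: sghost_upper].
- by exists 0, 0; rewrite lact0.
- move=> /[dup] /IHx[a [b [xa xb]]] /IHy[a' [b' [ya yb]]].
  exists (Num.min a a'), (Num.max b b'); rewrite lactD; split.
    apply: lower_boundedD; [apply: lower_boundedW xa | apply: lower_boundedW ya].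
    - by rewrite ge_min lexx.
    - by rewrite ge_min lexx orbT.
  apply: upper_boundedD; [apply: upper_boundedW xb | apply: upper_boundedW yb].
  - by rewrite le_max lexx.
  - by rewrite le_max lexx orbT.
- move=> /IH[a [b [fa fb]]]; exists a, b; rewrite lactZ.
  by split; [exact: lower_boundedZ | exact: upper_boundedZ].
- by rewrite lactM => /IHy /IHx.
Qed.

(** If no degree were the top one, the upper bound b could be lowered by 1 indefinitely and f would
    vanish. *)
Lemma top_degree_exists b f : upper_bounded b f -> f <> 0 -> exists m, top_degree m f.
Proof.
move=> fb f0; apply: contrapT => nm; apply: f0.
have fu (n : nat) : upper_bounded (b - n%:Z) f.
  elim: n => [|n IH]; first by rewrite subr0.
  move=> p d; rewrite intS opprD addrCA addrC ltrBlDr ltzD1 le_eqVlt.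
  move=> /orP[/eqP dE|]; last exact: IH.
  apply: contrapT => fpd; apply: nm; exists d; split; first by rewrite -dE.
  by exists p; exact/eqP.
(* With n = |b - d + 1|, the bound b - n is below d. *)
apply/funext => p; apply/funext => d; rewrite (fu (absz (b - d + 1))) //.
rewrite ltrBlDr -ltrBlDl; apply: lt_le_trans (ler_norm _).
by rewrite ltrDl.
Qed.

Lemma bottom_degree_exists a f : lower_bounded a f -> f <> 0 ->
  exists m, lower_bounded m f /\ exists p, f p m != 0.
Proof.
move=> fa f0; apply: contrapT => nm; apply: f0.
have fl (n : nat) : lower_bounded (a + n%:Z) f.
  elim: n => [|n IH]; first by rewrite addr0.
  move=> p d; rewrite intS addrCA addrC ltzD1 le_eqVlt => /orP[/eqP dE|]; last exact: IH.
  apply: contrapT => fpd; apply: nm; exists d; split; first by rewrite dE.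
  by exists p; exact/eqP.
apply/funext => p; apply/funext => d; rewrite (fl (absz (d - a + 1))) //.
rewrite -ltrBlDl; apply: lt_le_trans (ler_norm _).
by rewrite ltrDl.
Qed.

End Action.

(** * Spans of paths and ghost paths, filtered by length *)

Section Filtrations.
Variables (K : fieldType) (G : ultragraph).
Notation L := (leavitt K G).
Notation gproj := (gproj K).
Notation vproj := (vproj K).
Notation sedge := (sedge K).
Notation sghost := (sghost K).
Implicit Types (x y q : L) (A B : set (vertex G)) (e : edge G) (w v : vertex G).

Lemma scale_mull k x y : (k *: x) ** y = k *: (x ** y).
Proof. by rewrite rngscalerAl. Qed.

Lemma scale_mulr k x y : x ** (k *: y) = k *: (x ** y).
Proof. by rewrite rngscalerAr. Qed.

(* Spanned by the s_a p_A, with a a path of length at most n. *)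
Inductive path_span : nat -> L -> Prop :=
| path_span_gproj n A : genvertex A -> path_span n (gproj A)
| path_span0 n : path_span n 0
| path_spanD n x y : path_span n x -> path_span n y -> path_span n (x + y)
| path_spanZ n k x : path_span n x -> path_span n (k *: x)
| path_span_sedge n e x : path_span n x -> path_span n.+1 (sedge e ** x).

(* Spanned by the s_a p_A s_b^*, with a and b paths, b of length at most n. *)
Inductive ghost_span : nat -> L -> Prop :=
| ghost_span_path n m x : path_span m x -> ghost_span n x
| ghost_spanD n x y : ghost_span n x -> ghost_span n y -> ghost_span n (x + y)
| ghost_spanZ n k x : ghost_span n x -> ghost_span n (k *: x)
| ghost_span_sghost n e x : ghost_span n x -> ghost_span n.+1 (x ** sghost e).

Lemma path_spanW n m x : (n <= m)%N -> path_span n x -> path_span m x.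
Proof.
move=> nm px; elim: px m nm => {n x}
  [n A gA|n|n x y _ IHx _ IHy|n k x _ IH|n e x _ IH] m nm.
- exact: path_span_gproj.
- exact: path_span0.
- by apply: path_spanD; [exact: IHx | exact: IHy].
- by apply: path_spanZ; exact: IH.
- by case: m nm => // m nm; apply: path_span_sedge; exact: IH.
Qed.

Lemma path_spanB n m x y : path_span n x -> path_span m y ->
  path_span (maxn n m) (x - y).
Proof.
move=> px py; apply: path_spanD; first exact: path_spanW (leq_maxl _ _) px.
by rewrite -scaleN1r; apply: path_spanZ; exact: path_spanW (leq_maxr _ _) py.
Qed.

Lemma path_span_sum (I : Type) (r : seq I) n (F : I -> L) :
  (forall i, path_span n (F i)) -> path_span n (\sum_(i <- r) F i).
Proof.
move=> pF; elim/big_ind: _ => [|x y|i _]; [exact: path_span0| exact: path_spanD|exact: pF].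
Qed.

Lemma ghost_spanW n m x : (n <= m)%N -> ghost_span n x -> ghost_span m x.
Proof.
move=> nm px; elim: px m nm => {n x}
  [n l x px|n x y _ IHx _ IHy|n k x _ IH|n e x _ IH] m nm.
- exact: ghost_span_path px.
- by apply: ghost_spanD; [exact: IHx | exact: IHy].
- by apply: ghost_spanZ; exact: IH.
- by case: m nm => // m nm; apply: ghost_span_sghost; exact: IH.
Qed.

Lemma path_span_gprojl n x A : genvertex A -> path_span n x -> path_span n (gproj A ** x).
Proof.
move=> gA; elim=> {n x} [n B gB|n|n x y _ IHx _ IHy|n k x _ IH|n e x px _].
- by rewrite gprojI //; apply: path_span_gproj; exact: genvertexI.
- by rewrite rng0r; exact: path_span0.
- by rewrite rngmulDr; exact: path_spanD.
- by rewrite scale_mulr; exact: path_spanZ.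
- rewrite rngmulA gproj_sedge //; case: ifP => _; first exact: path_span_sedge.
  by rewrite rng0l; exact: path_span0.
Qed.

Lemma path_span_gprojr n x A : genvertex A -> path_span n x -> path_span n (x ** gproj A).
Proof.
move=> gA; elim=> {n x} [n B gB|n|n x y _ IHx _ IHy|n k x _ IH|n e x px IH].
- by rewrite gprojI //; apply: path_span_gproj; exact: genvertexI.
- by rewrite rng0l; exact: path_span0.
- by rewrite rngmulDl; exact: path_spanD.
- by rewrite scale_mull; exact: path_spanZ.
- by rewrite -rngmulA; exact: path_span_sedge.
Qed.

Lemma path_span_sedger n x e : path_span n x -> path_span n.+1 (x ** sedge e).
Proof.
elim=> {n x} [n B gB|n|n x y _ IHx _ IHy|n k x _ IH|n e' x px IH].
- rewrite gproj_sedge //; case: ifP => _; last exact: path_span0.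
  rewrite -sedge_range; apply: path_span_sedge; apply: path_span_gproj.
  exact: genvertex_range.
- by rewrite rng0l; exact: path_span0.
- by rewrite rngmulDl; exact: path_spanD.
- by rewrite scale_mull; exact: path_spanZ.
- by rewrite -rngmulA; exact: path_span_sedge.
Qed.

Lemma ghost_span0 n : ghost_span n 0.
Proof. exact: (@ghost_span_path _ 0 _ (path_span0 _)). Qed.

Lemma ghost_span_gprojr n x A : genvertex A ->
  ghost_span n x -> ghost_span n (x ** gproj A).
Proof.
move=> gA; elim=> {n x} [n m x px|n x y _ IHx _ IHy|n k x _ IH|n e x px IH].
- exact: ghost_span_path (path_span_gprojr gA px).
- by rewrite rngmulDl; exact: ghost_spanD.
- by rewrite scale_mull; exact: ghost_spanZ.
- rewrite -rngmulA sghost_gproj //; case: ifP => _; first exact: ghost_span_sghost.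
  by rewrite rng0r; exact: ghost_span0.
Qed.

(** The new edge meets the last ghost edge: equal edges cancel to a range projection and distinct
    ones give 0, so the ghost length does not grow. *)
Lemma ghost_span_sedger n x e : ghost_span n x -> ghost_span n (x ** sedge e).
Proof.
elim=> {n x} [n m x px|n x y _ IHx _ IHy|n k x _ IH|n e' x px IH].
- exact: ghost_span_path (path_span_sedger e px).
- by rewrite rngmulDl; exact: ghost_spanD.
- by rewrite scale_mull; exact: ghost_spanZ.
- rewrite -rngmulA; have [->|ee'] := eqVneq e' e.
    rewrite sghost_sedge; apply: ghost_spanW (leqnSn n) _.
    by apply: ghost_span_gprojr => //; exact: genvertex_range.
  by rewrite sghost_sedge_neq ?rng0r; [exact: ghost_span0|exact/eqP].
Qed.

Lemma ghost_span_total x : exists n, ghost_span n x.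
Proof.
(* Stability under right multiplication is proved by induction on the factor y, which avoids
   multiplying two spanning elements. *)
have Wmul y : forall n z, ghost_span n z -> exists m, ghost_span m (z ** y).
  elim/leavitt_ind: y => [A gA|e|e||y z IHy IHz|k y IH|y z IHy IHz] n t nt.
  - by exists n; exact: ghost_span_gprojr.
  - by exists n; exact: ghost_span_sedger.
  - by exists n.+1; exact: ghost_span_sghost.
  - by exists n; rewrite rng0r; exact: ghost_span0.
  - have [m my] := IHy _ _ nt; have [l lz] := IHz _ _ nt; exists (maxn m l).
    rewrite rngmulDr; apply: ghost_spanD.
      exact: ghost_spanW (leq_maxl _ _) my.
    exact: ghost_spanW (leq_maxr _ _) lz.
  - by have [m my] := IH _ _ nt; exists m; rewrite scale_mulr; exact: ghost_spanZ.
  - by have [m my] := IHy _ _ nt; have [l] := IHz _ _ my; exists l; rewrite rngmulA.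
elim/leavitt_ind: x => [A gA|e|e||x y [n nx] [m my]|k x [n nx]|x y [n nx] _].
- exists 0%N; apply: (@ghost_span_path _ 0); exact: path_span_gproj.
- exists 0%N; apply: (@ghost_span_path _ 1); rewrite -sedge_range.
  by apply: path_span_sedge; apply: path_span_gproj; exact: genvertex_range.
- exists 1%N; rewrite -range_sghost; apply: ghost_span_sghost.
  by apply: (@ghost_span_path _ 0); apply: path_span_gproj; exact: genvertex_range.
- by exists 0%N; exact: ghost_span0.
- exists (maxn n m); apply: ghost_spanD.
    exact: ghost_spanW (leq_maxl _ _) nx.
  exact: ghost_spanW (leq_maxr _ _) my.
- by exists n; exact: ghost_spanZ.
- exact: Wmul nx.
Qed.

Lemma sum_widen (E E' : seq (edge G)) (F : edge G -> L) : uniq E -> uniq E' ->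
  {subset E <= E'} -> (forall e, e \notin E -> F e = 0) ->
  \sum_(e <- E') F e = \sum_(e <- E) F e.
Proof.
move=> uE uE' EE' F0; rewrite (bigID (mem E)) /= [X in _ + X]big1 ?addr0 //.
rewrite -big_filter; apply/perm_big/uniq_perm => //; first exact: filter_uniq.
move=> e; rewrite mem_filter /=; apply/andP/idP => [[]//|eE]; split=> //.
exact: EE'.
Qed.

(** Families are total and vanish off a duplicate-free list, so that two of them can be added after
    widening to a common list. *)
Definition edge_family_on (E : seq (edge G)) (y : edge G -> L) :=
  uniq E /\ forall e, e \notin E -> y e = 0.

Lemma edge_family_onW (E E' : seq (edge G)) (y : edge G -> L) :
  uniq E' -> {subset E <= E'} ->
  edge_family_on E y -> edge_family_on E' y.
Proof.
by move=> uE' EE' [_ y0]; split=> // e eE'; apply: y0; apply: contra eE'; exact: EE'.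
Qed.

(** Paths are sorted by their first edge. The condition [gproj (edge_range e) ** y e = y e] makes
    [y e] recoverable from the sum by multiplying with s_e^* on the left. As [n.-1] is 0 at n = 0,
    the emptiness of E in that case is stated separately. *)
Lemma path_span_decomp n x : path_span n x ->
  exists q (E : seq (edge G)) (y : edge G -> L),
  [/\ path_span 0 q /\ edge_family_on E y, (forall e, path_span n.-1 (y e)),
      (forall e, gproj (edge_range e) ** y e = y e), (n = 0%N -> E = [::]) &
      x = q + \sum_(e <- E) sedge e ** y e].
Proof.
elim=> {n x} [n A gA|n|n x x' _ [q [E [y [[q0 Ey] yn yr nE ->]]]] _
  [q' [E' [y' [[q'0 Ey'] y'n y'r nE' ->]]]]|
  n k x _ [q [E [y [[q0 [uE y0]] yn yr nE ->]]]]|n e x px _].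
- exists (gproj A), [::], (fun=> 0); split=> //.
  + by split=> //; exact: path_span_gproj.
  + by move=> e; exact: path_span0.
  + by move=> e; rewrite rng0r.
  + by rewrite big_nil addr0.
- exists 0, [::], (fun=> 0); split=> //.
  + by split=> //; exact: path_span0.
  + by move=> e; exact: path_span0.
  + by move=> e; rewrite rng0r.
  + by rewrite big_nil addr0.
- pose F := undup (E ++ E').
  have uF : uniq F by exact: undup_uniq.
  have EF : {subset E <= F} by move=> e eE; rewrite mem_undup mem_cat eE.
  have E'F : {subset E' <= F} by move=> e eE; rewrite mem_undup mem_cat eE orbT.
  exists (q + q'), F, (fun e => y e + y' e); split.
  + split; first exact: path_spanD.
    have [_ yF] := edge_family_onW uF EF Ey; have [_ y'F] := edge_family_onW uF E'F Ey'.
    by split=> // e eF; rewrite yF // y'F // addr0.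
  + by move=> e; exact: path_spanD.
  + by move=> e; rewrite rngmulDr yr y'r.
  + by move=> n0; rewrite /F nE // nE'.
  + under [in RHS]eq_bigr do rewrite rngmulDr.
    have [uE y0] := Ey; have [uE' y'0] := Ey'.
    rewrite big_split /= (sum_widen uE uF EF) => [|e /y0 ->]; last by rewrite rng0r.
    rewrite (sum_widen uE' uF E'F) => [|e /y'0 ->]; last by rewrite rng0r.
    by rewrite addrACA.
- exists (k *: q), E, (fun e => k *: y e); split=> //.
  + split; first exact: path_spanZ.
    by split=> // e /y0 ->; rewrite scaler0.
  + by move=> e; exact: path_spanZ.
  + by move=> e; rewrite scale_mulr yr.
  + by rewrite scalerDr scaler_sumr; under [in RHS]eq_bigr do rewrite scale_mulr.
- have gr := genvertex_range e.
  (* Inserting p_{r(e)} after s_e changes nothing and provides the required normalisation. *)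
  exists 0, [:: e], (fun e' => if e' == e then gproj (edge_range e) ** x else 0).
  split=> //.
  + split; first exact: path_span0.
    by split=> // e'; rewrite inE => /negbTE ->.
  + by move=> e'; case: eqP => _; [exact: path_span_gprojl | exact: path_span0].
  + move=> e'; case: eqP => [->|_]; last by rewrite rng0r.
    by rewrite rngmulA gprojI // setIid.
  + by rewrite big_seq1 add0r eqxx rngmulA sedge_range.
Qed.

Lemma ghost_span_decomp n x : ghost_span n x -> exists m y E z,
  [/\ path_span m y, edge_family_on E z, (forall e, ghost_span n.-1 (z e)),
      (n = 0%N -> E = [::]) & x = y + \sum_(e <- E) z e ** sghost e].
Proof.
elim=> {n x} [n m x px|n x x' _ [m [y [E [z [ym Ez zn nE ->]]]]] _
  [m' [y' [E' [z' [ym' Ez' zn' nE' ->]]]]]|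
  n k x _ [m [y [E [z [ym [uE z0] zn nE ->]]]]]|n e x gx _].
- exists m, x, [::], (fun=> 0); split=> //; first by move=> e; exact: ghost_span0.
  by rewrite big_nil addr0.
- pose F := undup (E ++ E').
  have uF : uniq F by exact: undup_uniq.
  have EF : {subset E <= F} by move=> e eE; rewrite mem_undup mem_cat eE.
  have E'F : {subset E' <= F} by move=> e eE; rewrite mem_undup mem_cat eE orbT.
  exists (maxn m m'), (y + y'), F, (fun e => z e + z' e); split.
  + apply: path_spanD; first exact: path_spanW (leq_maxl _ _) ym.
    exact: path_spanW (leq_maxr _ _) ym'.
  + have [_ zF] := edge_family_onW uF EF Ez; have [_ z'F] := edge_family_onW uF E'F Ez'.
    by split=> // e eF; rewrite zF // z'F // addr0.
  + by move=> e; exact: ghost_spanD.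
  + by move=> n0; rewrite /F nE // nE'.
  + under [in RHS]eq_bigr do rewrite rngmulDl.
    have [uE z0] := Ez; have [uE' z'0] := Ez'.
    rewrite big_split /= (sum_widen uE uF EF) => [|e /z0 ->]; last by rewrite rng0l.
    rewrite (sum_widen uE' uF E'F) => [|e /z'0 ->]; last by rewrite rng0l.
    by rewrite addrACA.
- exists m, (k *: y), E, (fun e => k *: z e); split=> //.
  + exact: path_spanZ.
  + by split=> // e /z0 ->; rewrite scaler0.
  + by move=> e; exact: ghost_spanZ.
  + by rewrite scalerDr scaler_sumr; under [in RHS]eq_bigr do rewrite scale_mull.
- exists 0%N, 0, [:: e], (fun e' => if e' == e then x else 0); split=> //.
  + exact: path_span0.
  + by split=> // e'; rewrite inE => /negbTE ->.
  + by move=> e'; case: eqP => _ //; exact: ghost_span0.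
  + by rewrite big_seq1 add0r eqxx.
Qed.

Lemma path_span0_sum q : path_span 0 q -> exists l : seq (K * set (vertex G)),
  (forall p, p \in l -> genvertex p.2) /\ q = \sum_(p <- l) p.1 *: gproj p.2.
Proof.
move: {-2}0%N (erefl 0%N) => n n0 pq.
elim: pq n0 => {n q} [n A gA _|n _|n x y _ IHx _ IHy n0|n k x _ IH n0|//].
- exists [:: (1, A)]; split; first by move=> p; rewrite inE => /eqP ->.
  by rewrite big_seq1 scale1r.
- by exists [::]; rewrite big_nil.
- have [l [lg ->]] := IHx n0; have [l' [lg' ->]] := IHy n0.
  exists (l ++ l'); rewrite big_cat; split=> // p; rewrite mem_cat => /orP[].
    exact: lg.
  exact: lg'.
- have [l [lg ->]] := IH n0; exists [seq (k * p.1, p.2) | p <- l]; split.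
    by move=> _ /mapP[p pl ->]; exact: (lg p).
  by rewrite big_map scaler_sumr; apply: eq_bigr => p _; rewrite scalerA.
Qed.

Lemma gproj_dproj A B C : genvertex A -> genvertex B -> genvertex C ->
  gproj A ** dproj K B C = dproj K (A `&` B) C.
Proof.
move=> gA gB gC; have gBC := genvertexI gB gC.
by rewrite /dproj rngBr !gprojI // setIA.
Qed.

Lemma dproj_sub B C : genvertex B -> B `<=` C -> dproj K B C = 0.
Proof. by move=> gB /setIidl BC; rewrite /dproj BC subrr. Qed.

(** Each A of the list cuts B \ C in two: inside A the constant c becomes c + k, outside it stays.
    When the list is exhausted, either B \ C is empty or one of its vertices gives c = 0. *)
Lemma dproj_comb_eq0 (l : seq (K * set (vertex G))) c B C :
  (forall p, p \in l -> genvertex p.2) -> genvertex B -> genvertex C ->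
  (forall v, B v -> ~ C v ->
     c + \sum_(p <- l) (if `[< p.2 v >] then p.1 else 0) = 0) ->
  c *: dproj K B C + \sum_(p <- l) p.1 *: (gproj p.2 ** dproj K B C) = 0.
Proof.
elim: l c B C => [|[k A] l IH] c B C lg gB gC lc.
  rewrite big_nil addr0; have [BC|] := pselect (B `<=` C).
    by rewrite dproj_sub // scaler0.
  move=> /existsNP[v /not_implyP[Bv nCv]]; have := lc v Bv nCv.
  by rewrite big_nil addr0 => ->; rewrite scale0r.
have gA : genvertex A by apply: (lg (k, A)); rewrite inE eqxx.
have {}lg p : p \in l -> genvertex p.2 by move=> pl; apply: lg; rewrite inE pl orbT.
have gAB := genvertexI gA gB; have gAC := genvertexU gA gC.
have IH1 : (c + k) *: dproj K (A `&` B) C +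
    \sum_(p <- l) p.1 *: (gproj p.2 ** dproj K (A `&` B) C) = 0.
  apply: IH => // v [Av Bv] nCv; have := lc v Bv nCv.
  by rewrite big_cons /= asboolT // addrA.
have IH2 : c *: dproj K B (A `|` C) +
    \sum_(p <- l) p.1 *: (gproj p.2 ** dproj K B (A `|` C)) = 0.
  apply: IH => // v Bv /not_orP[nAv nCv]; have := lc v Bv nCv.
  by rewrite big_cons /= asboolF // add0r.
rewrite big_cons /= (dproj_split _ gA gB gC).
under eq_bigr do rewrite rngmulDr scalerDr.
rewrite big_split /= rngmulDr gproj_dproj // setIA setIid.
have -> : gproj A ** dproj K B (A `|` C) = 0.
  by rewrite gproj_dproj // dproj_sub // => v [Av _]; left.
rewrite addr0 scalerDr [LHS](AC (2*(1*2)) ((1*3*4)*(2*5)))/=.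
by rewrite -scalerDl IH1 IH2 addr0.
Qed.

End Filtrations.

(** * From a radical element to a contradiction *)

Section Reduction.
Variables (K : fieldType) (G : ultragraph) (br : branching G).
Notation L := (leavitt K G).
Notation V := ((vertex G * nat)%type -> int -> K^o).
Notation gproj := (gproj K).
Notation vproj := (vproj K).
Notation sedge := (sedge K).
Notation sghost := (sghost K).
Notation lact := (@lact K G br).
Implicit Types (x y q : L) (f g : V) (A B : set (vertex G)) (e : edge G) (w v : vertex G).

Lemma gproj_comb_vproj (l : seq (K * set (vertex G))) v :
  (forall p, p \in l -> genvertex p.2) ->
  (\sum_(p <- l) p.1 *: gproj p.2) ** vproj v =
  (\sum_(p <- l) (if `[< p.2 v >] then p.1 else 0)) *: vproj v.
Proof.
move=> lg; rewrite rng_suml scaler_suml !big_seq; apply: eq_bigr => p pl.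
rewrite scale_mull gproj_vproj; last exact: lg.
by case: ifP; rewrite ?scaler0 ?scale0r.
Qed.

Lemma path_span0_vproj q v : path_span 0 q -> exists c, q ** vproj v = c *: vproj v.
Proof. by move=> /path_span0_sum[l [lg ->]]; eexists; exact: gproj_comb_vproj. Qed.

(** As p_v is nonzero, q p_v = 0 says that the coefficients of the sets containing v add up to 0.
    Inclusion-exclusion, started from a generalized vertex B above all the sets involved, turns this
    into q = 0. *)
Lemma path_span0_eq0 q : path_span 0 q -> (forall v, q ** vproj v = 0) -> q = 0.
Proof.
move=> /path_span0_sum[l [lg ->]] lv.
have [B gB lB] : exists2 B, genvertex B & forall p, p \in l -> p.2 `<=` B.
  elim: l lg {lv} => [|p l IH] lg; first by exists set0 => //; exact: genvertex0.
  have [|B gB lB] := IH; first by move=> r rl; apply: lg; rewrite inE rl orbT.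
  exists (p.2 `|` B).
    by apply: genvertexU => //; apply: lg; rewrite inE eqxx.
  by move=> r; rewrite inE => /orP[/eqP ->|/lB rB] v; [left | right; exact: rB].
have := @dproj_comb_eq0 K G l 0 B set0 lg gB (@genvertex0 G).
rewrite scale0r add0r /dproj setI0 gproj_set0 subr0 => lE; rewrite -[RHS]lE.
  rewrite !big_seq; apply: eq_bigr => p pl; have gp := lg _ pl.
  by rewrite gprojI // setIidl //; exact: lB.
move=> v _ _; rewrite add0r; have /eqP := lv v; rewrite gproj_comb_vproj //.
by rewrite scaler_eq0 => /orP[/eqP //|/eqP/(vproj_neq0 br)].
Qed.

Lemma path_span_lower n m x f : path_span n x ->
  lower_bounded m f -> lower_bounded m (lact x f).
Proof.
move=> px fm; elim: px => {n x} [n A gA|n|n x y _ IHx _ IHy|n k x _ IH|n e x _ IH].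
- exact: gproj_lower.
- by rewrite lact0.
- by rewrite lactD; exact: lower_boundedD.
- by rewrite lactZ; exact: lower_boundedZ.
- rewrite lactM; apply: (lower_boundedW _ (sedge_lower br e IH)).
  by rewrite lerDl.
Qed.

Lemma sedge_sum_lower (E : seq (edge G)) (y : edge G -> L) n m f :
  (forall e, path_span n (y e)) -> lower_bounded m f ->
  lower_bounded (m + 1) (lact (\sum_(e <- E) sedge e ** y e) f).
Proof.
move=> yn fm; rewrite lact_sum; elim/big_ind: _ => [//|g h|e _].
  exact: lower_boundedD.
by rewrite lactM; apply: sedge_lower; exact: path_span_lower (yn e) fm.
Qed.

Lemma sghost_sedge_sum (E : seq (edge G)) (y : edge G -> L) e :
  edge_family_on E y -> (forall e, gproj (edge_range e) ** y e = y e) ->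
  sghost e ** (\sum_(e' <- E) sedge e' ** y e') = y e.
Proof.
move=> [uE y0] yr; rewrite rng_sumr; have [eE|/[dup] eE /y0 ->] := boolP (e \in E).
  rewrite (bigD1_seq e) //= rngmulA sghost_sedge yr big1 ?addr0 // => e' /eqP e'e.
  by rewrite rngmulA sghost_sedge_neq ?rng0l // => ee'; apply: e'e.
rewrite big_seq big1 // => e' e'E; rewrite rngmulA sghost_sedge_neq ?rng0l //.
by move=> ee'; move: eE; rewrite ee' e'E.
Qed.

Lemma lact_vproj_scalar q w c f : q ** vproj w = c *: vproj w ->
  lact (vproj w) f = f -> lact q f = c *: f.
Proof. by move=> qc fw; rewrite -{1}fw -lactM qc lactZ fw. Qed.

(** On a basepoint the terms s_e y_e contribute only from degree 1 on, so degree 0 isolates q and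
    shows q = 0. Then y_e = s_e^* x inherits the hypothesis, and the induction applies. *)
Lemma path_span_eq0 n x : path_span n x -> (forall v, x ** vproj v = 0) -> x = 0.
Proof.
elim: n x => [|n IH] x px xv; first exact: path_span0_eq0 px xv.
have [q [E [y [[q0 Ey] yn yr _ xE]]]] := path_span_decomp px.
have qv v : q ** vproj v = 0.
  have [c qc] := path_span0_vproj v q0.
  have /(congr1 (fun z => lact z (basepoint K v) (v, 0%N) 0)) := xv v.
  rewrite lact0 lactM vproj_basepoint xE lactD.
  rewrite (lact_vproj_scalar qc (vproj_basepoint K br v)).
  have := sedge_sum_lower E yn (@basepoint_lower K G v).
  rewrite add0r !fctE => -> //; rewrite addr0 /basepoint !eqxx /= => c0.
  have {}c0 : c = 0 by rewrite -[LHS]mulr1.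
  by rewrite qc c0 scale0r.
have q_eq0 : q = 0 by exact: path_span0_eq0 q0 qv.
rewrite xE q_eq0 add0r big1 // => e _.
suff -> : y e = 0 by rewrite rng0r.
apply: IH => // v; rewrite -(sghost_sedge_sum e Ey yr).
have -> : \sum_(e' <- E) sedge e' ** y e' = x by rewrite xE q_eq0 add0r.
by rewrite -rngmulA xv rng0r.
Qed.

Definition raises w (d : nat) x := forall f m,
  lact (vproj w) f = f -> top_degree m f -> top_degree (m + d%:Z) (lact x f).

Lemma top_degreeZ k m f : k != 0 -> top_degree m f -> top_degree m (k *: f).
Proof.
move=> k0 [fm [p fp]]; split; first exact: upper_boundedZ.
by exists p; rewrite !fctE scaler_eq0 negb_or k0.
Qed.

(** If every [y e ** vproj w] vanishes, only the scalar part acts and d = 0; otherwise d is one more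
    than the largest shift of a surviving [y e]. The leading parts for different edges cannot
    cancel, since s_e produces functions supported on points that begin with e. *)
Lemma path_span_raises n x w : path_span n x -> x ** vproj w <> 0 ->
  exists d, raises w d x.
Proof.
elim: n x => [|n IH] x px xw.
all: have [q [E [y [[q0 Ey] yn yr nE xE]]]] := path_span_decomp px.
all: have [c qc] := path_span0_vproj w q0.
all: have qf := lact_vproj_scalar qc.
  exists 0%N => f m fw fm; rewrite addr0 xE nE // big_nil addr0 qf //.
  apply: top_degreeZ => //; apply/eqP => c0; apply: xw.
  by rewrite xE nE // big_nil addr0 qc c0 scale0r.
have /choice[d dP] e : exists d, y e ** vproj w <> 0 -> raises w d (y e).
  have [ye|ye] := pselect (y e ** vproj w = 0); first by exists 0%N.
  by have [d] := IH _ (yn e) ye; exists d.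
have y0f e f : y e ** vproj w = 0 -> lact (vproj w) f = f -> lact (y e) f = 0.
  by move=> ye fw; rewrite -fw -lactM ye lact0.
have [yw|/existsNP[e1 e1w]] := pselect (forall e, y e ** vproj w = 0).
  exists 0%N => f m fw fm; rewrite addr0 xE lactD qf // lact_sum big1 ?addr0.
    apply: top_degreeZ => //; apply/eqP => c0; apply: xw; rewrite xE rngmulDl qc c0.
    rewrite scale0r add0r rng_suml big1 // => e _.
    by rewrite -rngmulA yw rng0r.
  by move=> e _; rewrite lactM (y0f _ _ (yw e) fw) lact0r.
have uE : uniq E by case: Ey.
have wE e : y e ** vproj w <> 0 -> e \in E.
  by case: Ey => _ y0 ye; apply: contrapT => /negP/y0 y0e; apply: ye; rewrite y0e rng0l.
pose F := [seq e <- E | `[< y e ** vproj w <> 0 >]].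
have FP e : e \in F <-> y e ** vproj w <> 0.
  rewrite mem_filter; split=> [/andP[/asboolP //]|ye].
  by apply/andP; split; [exact/asboolP | exact: wE].
have [e0 e0w dmax] : exists2 e0, y e0 ** vproj w <> 0 &
    forall e, y e ** vproj w <> 0 -> (d e <= d e0)%N.
  pose i0 : seq_sub F := SeqSub ((FP e1).2 e1w).
  have [i _ imax] := arg_maxnP (fun i : seq_sub F => d (val i)) (isT : xpredT i0).
  exists (val i); first exact/FP/valP.
  by move=> e /FP eF; exact: (imax (SeqSub eF)).
exists (d e0).+1 => f m fw fm; have [fu _] := fm.
have upy e : upper_bounded (m + (d e0)%:Z) (lact (y e) f).
  have [ye|ye] := pselect (y e ** vproj w = 0); first by rewrite y0f.
  have [gu _] := dP e ye f m fw fm; apply: upper_boundedW gu.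
  by rewrite lerD2l lez_nat dmax.
have [_ [p gp]] := dP e0 e0w f m fw fm.
(* The image of [y e0] is supported over r(e0), so e0 can be prepended to p. *)
have pr : edge_range e0 p.1.
  apply: contrapT => npr; move: gp; rewrite -yr lactM.
  rewrite lact_gproj; last exact: genvertex_range.
  by rewrite asboolF // eqxx.
rewrite xE lactD qf // lact_sum intS (addrC 1) addrA; split.
  apply: upper_boundedD.
    by apply/upper_boundedZ/(upper_boundedW _ fu); rewrite -addrA lerDl addr_ge0.
  elim/big_ind: _ => [//|g h|e _]; first exact: upper_boundedD.
  by rewrite lactM; exact: sedge_upper.
(* Here q f vanishes, the degree being above m, and so do the terms of all edges other than e0. *)
exists (branch_cons br e0 p); rewrite !fctE fu; last first.
  by rewrite -addrA ltrDl ltr_wpDl.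
rewrite scaler0 add0r !fct_sumE (bigD1_seq e0) ?wE //= big1 => [|e /negbTE ee0].
  by rewrite addr0 lactM lact_sedge branch_consK // eqxx addrK.
by rewrite lactM lact_sedge branch_consK // eq_sym ee0.
Qed.

Lemma path_span_vertex n x : path_span n x -> x <> 0 -> exists v, x ** vproj v <> 0.
Proof.
move=> px x0; apply: contrapT => /forallNP xv; apply: x0.
by apply: path_span_eq0 px _ => v; apply: contrapT; exact: xv.
Qed.

(** Otherwise x raises degrees at the source of e, so it kills no vector fixed there that has a top
    degree; but s_e applied to a basepoint over r(e) is such a vector. This replaces relation (4) at
    infinite emitters. *)
Lemma path_span_emitter n x e : path_span n x -> x ** sedge e = 0 ->
  x ** vproj (edge_source e) = 0.
Proof.
move=> px xe; apply: contrapT => /(path_span_raises px)[d xd].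
have [w ew] := edge_range_neq0 e.
pose f := lact (sedge e) (basepoint K w).
have fv : lact (vproj (edge_source e)) f = f by rewrite -lactM vproj_sedge.
suff ft : top_degree 1 f.
  by apply: (top_degree_neq0 (xd _ _ fv ft)); rewrite -lactM xe lact0.
have [bu [p bp]] := basepoint_top K w; split; first exact: sedge_upper bu.
exists (branch_cons br e (w, 0%N)).
by rewrite /f lact_sedge branch_consK // eqxx subrr /basepoint !eqxx oner_neq0.
Qed.

(** If x s_e is nonzero for some e, it has smaller ghost length and the induction applies. If all x
    s_e vanish, then x p_v = 0 at every source v of a last ghost edge, and this forces x to be a
    combination of paths already. *)
Lemma ghost_span_reduce n x : ghost_span n x -> x <> 0 ->
  exists m b w, path_span m (x ** b) /\ x ** b ** vproj w <> 0.
Proof.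
have base m y : path_span m y -> y <> 0 ->
    exists m b w, path_span m (y ** b) /\ y ** b ** vproj w <> 0.
  move=> py /(path_span_vertex py)[v yv]; exists m, (vproj v), v.
  split; first by apply: path_span_gprojr => //; exact: genvertex1.
  by rewrite -rngmulA vproj_id.
elim: n x => [|n IH] x gx x0.
all: have [m [y [E [z [ym [uE z0] zn nE xE]]]]] := ghost_span_decomp gx.
  by apply: base x0; rewrite xE nE // big_nil addr0; exact: ym.
have [[e xe]|xe] := pselect (exists e, x ** sedge e <> 0).
  have [|l [b [w [lb bw]]]] := IH (x ** sedge e) _ xe; last first.
    by exists l, (sedge e ** b), w; rewrite rngmulA.
  rewrite xE rngmulDl rng_suml; apply: ghost_spanD.
    exact: ghost_span_path (path_span_sedger e ym).
  elim/big_ind: _ => [|u v|e' _]; [exact: ghost_span0 | exact: ghost_spanD |].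
  rewrite -rngmulA; have [->|e'e] := eqVneq e' e.
    by rewrite sghost_sedge; apply: ghost_span_gprojr => //; exact: genvertex_range.
  by rewrite sghost_sedge_neq ?rng0r; [exact: ghost_span0 | exact/eqP].
have {}xe e : x ** sedge e = 0 by apply: contrapT => xe'; apply: xe; exists e.
pose h := \sum_(e <- E) z e ** sghost e.
(* Since s_e^* s_e s_e^* = s_e^*, the ghost part h is determined by the products h s_e, which x s_e
   = 0 identifies with -(y s_e). *)
have hE : h = \sum_(e <- E) h ** sedge e ** sghost e.
  rewrite {1}/h !big_seq; apply: eq_bigr => e eE.
  rewrite /h rng_suml (bigD1_seq e) //= big1 => [|e' /eqP e'e]; last first.
    by rewrite -rngmulA sghost_sedge_neq ?rng0r.
  by rewrite addr0 -(rngmulA (z e)) sghost_sedge -rngmulA range_sghost.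
have hS e : h ** sedge e = - (y ** sedge e).
  by apply/eqP; rewrite -addr_eq0 addrC -rngmulDl -xE xe.
have Tv e v : sghost e ** vproj v = if edge_source e == v then sghost e else 0.
  rewrite sghost_gproj; last exact: genvertex1.
  by congr (if _ then _ else _); apply/asboolP/eqP.
have xv v : v \in map (@edge_source G) E -> x ** vproj v = 0.
  move=> /mapP[e0 e0E vE].
  have [vreg|vinf] := pselect (finite_set (out_edges v)).
    have rv : regular v by split=> //; exists e0.
    rewrite vproj_regular // rng_sumr big1 // => e _.
    by rewrite rngmulA xe rng0l.
  (* Infinitely many edges leave v, so one is outside E. All ghost terms kill it, hence y s_{e1} = x
     s_{e1} = 0. *)
  have [e1 e1v e1E] : exists2 e, edge_source e = v & e \notin E.
    apply: contrapT => nv; apply: vinf; apply: sub_finite_set (finite_seq E) => e ev.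
    by apply/negPn/negP => eE; apply: nv; exists e.
  have yv : y ** vproj v = 0.
    rewrite -e1v; apply: path_span_emitter ym _.
    have := xe e1; rewrite xE rngmulDl rng_suml big_seq big1 ?addr0 // => e eE.
    rewrite -rngmulA sghost_sedge_neq ?rng0r // => ee1.
    by move: e1E; rewrite -ee1 eE.
  rewrite xE rngmulDl yv add0r -/h hE rng_suml big1 // => e _.
  rewrite -rngmulA Tv; case: eqP => [ev|_]; last by rewrite rng0r.
  by rewrite hS -vproj_sedge ev rngmulA yv !(rng0l, oppr0).
pose F := undup (map (@edge_source G) E).
have hF : \sum_(v <- F) h ** vproj v = h.
  under eq_bigr do rewrite rng_suml; rewrite exchange_big /=.
  rewrite /h !big_seq; apply: eq_bigr => e eE.
  have eF : edge_source e \in F by rewrite mem_undup map_f.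
  rewrite (bigD1_seq _ eF) ?undup_uniq //= -rngmulA sghost_vproj big1 ?addr0 // => v.
  by rewrite eq_sym -rngmulA Tv => /negbTE ->; rewrite rng0r.
(* Summing x p_v = 0 over the sources in F, where h is its own sum of the h p_v, expresses h through
   y. *)
have xF : x = y - \sum_(v <- F) y ** vproj v.
  have : \sum_(v <- F) x ** vproj v = 0.
    by rewrite big_seq big1 // => v; rewrite mem_undup; exact: xv.
  rewrite (eq_bigr (fun v => y ** vproj v + h ** vproj v)) => [|v _]; last first.
    by rewrite {1}xE rngmulDl.
  rewrite big_split /= -/h hF => /eqP; rewrite addrC addr_eq0 => /eqP hy.
  by rewrite {1}xE -/h hy.
apply: (base m _ _ x0); rewrite xF -[m]maxnn; apply: path_spanB; first exact: ym.
apply: path_span_sum => v; apply: path_span_gprojr; last exact: ym.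
exact: genvertex1.
Qed.

(** While the scalar c at w is 0, some [y e ** vproj w] is nonzero; it equals s_e^* x p_w, so it
    stays in the radical and has shorter paths. *)
Lemma path_span_constant_term n x w : path_span n x -> x ** vproj w <> 0 ->
  radical x -> exists m c (E : seq (edge G)) (y : edge G -> L),
  [/\ c != 0, (forall e, path_span m (y e)) &
      radical (c *: vproj w + (\sum_(e <- E) sedge e ** y e) ** vproj w)].
Proof.
elim: n x => [|n IH] x px xw rx.
all: have [q [E [y [[q0 Ey] yn yr nE xE]]]] := path_span_decomp px.
all: have [c qc] := path_span0_vproj w q0.
all: have [c0|c0] := eqVneq c 0; last by
  eexists; exists c, E, y; split; [|exact: yn|rewrite -qc -rngmulDl -xE; exact: radicalMr].
  by case: xw; rewrite xE nE // big_nil addr0 qc c0 scale0r.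
have xwE : x ** vproj w = (\sum_(e <- E) sedge e ** y e) ** vproj w.
  by rewrite xE rngmulDl qc c0 scale0r add0r.
have [yw|/existsNP[e ew]] := pselect (forall e, y e ** vproj w = 0).
  case: xw; rewrite xwE rng_suml big1 // => e _.
  by rewrite -rngmulA yw rng0r.
apply: (IH (y e ** vproj w)).
- by apply: path_span_gprojr => //; exact: genvertex1.
- by rewrite -rngmulA vproj_id.
- rewrite -(sghost_sedge_sum e Ey yr) -rngmulA -xwE.
  by apply: radicalMl; exact: radicalMr.
Qed.

(** Multiplying the quasi-inverse equation of -p_w on the left by p_w cancels the unknown and leaves
    -p_w = 0. *)
Lemma radical_vproj w : ~ radical (vproj w).
Proof.
move=> /radicalN/radical_right_quasiregular[z zE]; apply: (@vproj_neq0 K G br w).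
have := congr1 (fun t => vproj w ** t) zE.
rewrite rng0r !rngmulDr rngNl !rngNr rngmulA vproj_id addrK => /eqP.
by rewrite oppr_eq0 => /eqP.
Qed.

Lemma top_degree_uniq m m' f : top_degree m f -> top_degree m' f -> m = m'.
Proof.
move=> [fm [p fp]] [fm' [p' fp']]; apply/eqP; rewrite eq_le !leNgt.
apply/andP; split; apply/negP => mm.
  by move: fp; rewrite fm' // eqxx.
by move: fp'; rewrite fm // eqxx.
Qed.

Lemma top_degreeD m m' f g : m < m' -> top_degree m f -> top_degree m' g ->
  top_degree m' (f + g).
Proof.
move=> mm' [fm _] [gm [p gp]]; split.
  by apply: upper_boundedD => //; exact: upper_boundedW (ltW mm') fm.
by exists p; rewrite !fctE fm // add0r.
Qed.

(* Otherwise p_w + g + g^2 has a right inverse p_w + p_w r. Applied to a vector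
   b of degree 0, it gives a u with u + (g + g^2) u = b. The lowest degree of u
   is then that of b, while comparing top degrees shows that the top degree of
   u is negative. *)
Lemma radical_constant_term w (g : L) n : g = vproj w ** g -> g ** vproj w = g ->
  path_span n g ->
  (forall m f, lower_bounded m f -> lower_bounded (m + 1) (lact g f)) ->
  ~ radical (vproj w + g).
Proof.
move=> wg gw pg glow rz.
have g0 : g <> 0 by move=> g0; apply: (@radical_vproj w); move: rz; rewrite g0 addr0.
have [d gd] : exists d, raises w d g by apply: (path_span_raises pg); rewrite gw.
set b := basepoint K w; have bw : lact (vproj w) b = b := vproj_basepoint K br w.
have bt : top_degree 0 b := basepoint_top K w.
have bl : lower_bounded 0 b := @basepoint_lower K G w.
(* By [glow], g b lives in degrees at least 1, whereas d = 0 would give it a nonzero value in degree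
   0. *)
have d0 : 0 < d%:Z.
  have [_ [p gp]] := gd _ _ bw bt; rewrite add0r in gp.
  by rewrite ltNge; apply/negP => d0; move: gp; rewrite (glow _ _ bl) ?eqxx // add0r.
pose z := g ** (vproj w + g).
have zE : z = g + g ** g by rewrite /z rngmulDr gw.
have [r rE] := radical_right_quasiregular (radicalMl g rz); rewrite -/z in rE.
pose s := vproj w + vproj w ** r.
have wz : vproj w ** z = z by rewrite /z rngmulA -wg.
have zw : z ** vproj w = z by rewrite zE rngmulDl -rngmulA gw.
have sE : s + z ** s = vproj w.
  rewrite /s rngmulDr zw (rngmulA z) zw -addrA.
  suff -> : vproj w ** r + (z + z ** r) = 0 by rewrite addr0.
  by rewrite -{1}wz -{2}wz -rngmulA -!rngmulDr addrCA addrA rE rng0r.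
pose u := lact s b.
have uE : u + lact z u = b by rewrite /u -lactM -lactD sE.
have uw : lact (vproj w) u = u.
  by rewrite /u -lactM /s rngmulDr rngmulA vproj_id.
have u0 : u <> 0.
  by move=> u0; apply: (top_degree_neq0 bt); rewrite -uE u0 lact0r addr0.
have [a [c [ua uc]]] : bounded u.
  by apply: lact_bounded; exists 0, 0; split=> //; case: bt.
have [m um] := top_degree_exists uc u0.
have [l [ul [p up]]] := bottom_degree_exists ua u0.
have gu := gd _ _ uw um.
have gwu : lact (vproj w) (lact g u) = lact g u by rewrite -lactM -wg.
have ggu := gd _ _ gwu gu.
have mm : m + d%:Z + d%:Z = 0.
  apply: top_degree_uniq bt; rewrite -uE zE lactD lactM addrA.
  have gtop : top_degree (m + d%:Z) (u + lact g u).
    by apply: top_degreeD um gu; rewrite ltrDl.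
  by apply: top_degreeD gtop ggu; rewrite ltrDl.
have l0 : l = 0.
  have blp : b p l != 0.
    rewrite -uE !fctE zE lactD !fctE lactM.
    rewrite (glow _ _ ul) ?ltrDl // (glow _ _ (glow _ _ ul)) ?addr0 //.
    by rewrite -addrA ltrDl.
  by move: blp; rewrite /b /basepoint; case: (l =P 0) => // _; rewrite andbF eqxx.
have [_ [p' up']] := um.
have m0 : 0 <= m by rewrite leNgt; apply/negP => m0; move: up'; rewrite ul ?l0 // eqxx.
by have := ltr_wpDl (addr_ge0 m0 (ltW d0)) d0; rewrite mm ltxx.
Qed.

Lemma radical_leavitt x : radical x -> x = 0.
Proof.
move=> rx; apply: contrapT => x0; have [n nx] := ghost_span_total x.
have [m [b [w [pb bw]]]] := ghost_span_reduce nx x0.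
have [k [c [E [y [c0 yk]]]]] := path_span_constant_term pb bw (radicalMr b rx).
set h := \sum_(e <- E) _ => rz.
have gw := genvertex1 w.
(* Left multiplication by c^-1 p_w stays in the radical, makes the constant term p_w and puts the
   rest in the corner at w. *)
pose g := c^-1 *: (vproj w ** h ** vproj w).
apply: (@radical_constant_term w g k.+1).
- by rewrite /g scale_mulr -!rngmulA !(rngmulA (vproj w) (vproj w)) vproj_id.
- by rewrite /g scale_mull -rngmulA vproj_id.
- apply/path_spanZ/path_span_gprojr/path_span_gprojl/path_span_sum => // e.
  exact: path_span_sedge.
- move=> l f fl; rewrite lactZ !lactM; apply/lower_boundedZ/gproj_lower => //.
  by apply: sedge_sum_lower yk _; exact: gproj_lower.
- have -> : vproj w + g = (c^-1 *: vproj w) ** (c *: vproj w + h ** vproj w).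
    rewrite rngmulDr !(scale_mull, scale_mulr) scalerA vproj_id mulVf // scale1r.
    by rewrite /g rngmulA.
  exact: radicalMl.
Qed.

End Reduction.

Theorem theorem4p2 (K : fieldType) (G : ultragraph) :
  semiprimitive (leavitt K G).
Proof.
have [br] := branching_exists G.
by apply: semiprimitive_radical0; exact: radical_leavitt br.
Qed.
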